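(* Let $H\colon[0,1]\times M\to\mathbb R$ be a smooth basic Hamiltonian, generating the strictly contact isotopy $\Phi_H=\{\phi_H^t\}$, and let $\epsilon>0$. Then there exists a smooth basic Hamiltonian $F\colon[0,1]\times M\to\mathbb R$, generating a strictly contact isotopy $\Phi_F$, such that (i) the end points of the isotopies coincide, i.e. $\phi_F^0=\phi_H^0$ and $\phi_F^1=\phi_H^1$; (ii) $\|F\|_{(1,\infty)}\le\|F\|_\infty<\|H\|_{(1,\infty)}+\epsilon$; (iii) $\overline d(\Phi_F,\phi_F^0)<\overline d(\Phi_H,\phi_H^0)+\epsilon$, where $\phi_F^0=\phi_H^0$ denotes the constant isotopy $t\mapsto\phi_F^0=\phi_H^0$.
   Context: $M$ is a closed (compact, without boundary), connected smooth manifold of dimension $2n+1$ with a cooriented contact structure $\xi=\ker\alpha$, where $\alpha$ is a fixed contact form with Reeb vector field $R$, and $\nu_\alpha=\alpha\wedge(d\alpha)^n$. A strictly contact isotopy here is a smooth isotopy $\Phi=\{\phi_t\}_{0\le t\le1}$ of diffeomorphisms with $\phi_t^*\alpha=\alpha$ for all $t$, whose time-zero map is not necessarily the identity; if $\frac{d}{dt}\phi_t=X_t\circ\phi_t$, its Hamiltonian is $H_t=\alpha(X_t)$, and one writes $\Phi=\Phi_H=\{\phi_H^t\}$ (for a given time-zero map, $H$ determines $\Phi_H$). The Hamiltonians so obtained are exactly the smooth basic functions, i.e. those with $dH_t(R)=0$ for all $t$. For a function $H$ on $M$, $\|H\|=\max_M H-\min_M H+\left|\frac{1}{\int_M\nu_\alpha}\int_M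 H\,\nu_\alpha\right|$. For $H\colon[0,1]\times M\to\mathbb R$, $\|H\|_{(1,\infty)}=\int_0^1\|H_t\|\,dt$ and $\|H\|_\infty=\max_t\|H_t\|$. Fix a Riemannian distance $d$ on $M$; $\overline d(\phi,\psi)=\max_x d(\phi(x),\psi(x))+\max_x d(\phi^{-1}(x),\psi^{-1}(x))$ for homeomorphisms and $\overline d(\Phi,\Psi)=\max_t\overline d(\phi_t,\psi_t)$ for isotopies. *)

(* Defs.v *)
From mathcomp Require Import all_boot all_order all_algebra all_fingroup.
From mathcomp Require Import all_classical all_reals all_analysis.
Set Implicit Arguments.
Unset Strict Implicit.
Unset Printing Implicit Defensive.
Import Order.TTheory GRing.Theory Num.Theory.
Import numFieldNormedType.Exports.
Local Open Scope classical_set_scope.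
Local Open Scope ring_scope.

(* Only finite-dimensional V are used below; there Ck is the usual class C^k. *)
Fixpoint Ck (R : realType) (V W : normedModType R) (k : nat) (U : set V)
    (f : V -> W) : Prop :=
  match k with
  | 0%N => forall x, U x -> {for x, continuous f}
  | k'.+1 => (forall x, U x -> differentiable f x) /\
             forall v : V, Ck k' U ('D_v f)
  end.

(* Smoothness on an arbitrary subset A (not necessarily open, e.g.
   [0,1] x U): locally, f is the restriction of a smooth function. *)
Definition smooth_on (R : realType) (V W : normedModType R) (A : set V)
    (f : V -> W) : Prop :=
  forall x, A x -> exists (U : set V) (g : V -> W),
    [/\ open U, U x, forall k, Ck k U g & forall y, U y -> A y -> f y = g y].

Record closed_manifold (R : realType) (m : nat) := ClosedManifold {
  carrier :> topologicalType;
  chart : Type;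
  dom : chart -> set carrier;
  cmap : chart -> carrier -> 'rV[R]_m;
  cinv : chart -> 'rV[R]_m -> carrier;
  dom_open : forall i, open (dom i);
  img_open : forall i, open (cmap i @` dom i);
  cmapK : forall i p, dom i p -> cinv i (cmap i p) = p;
  cmap_cont : forall i p, dom i p -> {for p, continuous (cmap i)};
  cinv_cont : forall i x, (cmap i @` dom i) x -> {for x, continuous (cinv i)};
  dom_cover : forall p, exists i, dom i p;
  transition_smooth : forall i j,
    smooth_on (cmap i @` (dom i `&` dom j)) (cmap j \o cinv i);
  carrier_hausdorff : hausdorff_space carrier;
  carrier_compact : compact [set: carrier];
  carrier_connected : connected [set: carrier];
  carrier_nonempty : [set: carrier] !=set0 }.

Section Manifold.
Context {R : realType} {m : nat} {M : closed_manifold R m}.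
Implicit Types (i j : chart M) (p q : M) (v w : 'rV[R]_m).

Definition img i : set 'rV[R]_m := cmap i @` dom i.

Definition dtrans i j p v : 'rV[R]_m := 'd (cmap j \o cinv i) (cmap i p) v.

(* Tensor fields are given by their components in all charts, subject to the
   transformation law; the value at i p is meaningful only when dom i p. *)
Definition pairing (a : 'cV[R]_m) v : R := (v *m a) 0 0.

Record one_form := OneForm {
  form_at :> chart M -> M -> 'cV[R]_m;
  form_smooth : forall i, smooth_on (img i) (form_at i \o cinv i);
  form_trans : forall i j p v, dom i p -> dom j p ->
    pairing (form_at i p) v = pairing (form_at j p) (dtrans i j p v) }.

Record vector_field := VectorField {
  vec_at :> chart M -> M -> 'rV[R]_m;
  vec_smooth : forall i, smooth_on (img i) (vec_at i \o cinv i);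
  vec_trans : forall i j p, dom i p -> dom j p ->
    vec_at j p = dtrans i j p (vec_at i p) }.

Definition gram (G : 'M[R]_m) v w : R := (v *m G *m w^T) 0 0.

Record riemannian_metric := RiemannianMetric {
  metric_at :> chart M -> M -> 'M[R]_m;
  metric_smooth : forall i, smooth_on (img i) (metric_at i \o cinv i);
  metric_sym : forall i p, dom i p -> (metric_at i p)^T = metric_at i p;
  metric_pos : forall i p v, dom i p -> v != 0 -> 0 < gram (metric_at i p) v v;
  metric_trans : forall i j p v w, dom i p -> dom j p ->
    gram (metric_at i p) v w =
    gram (metric_at j p) (dtrans i j p v) (dtrans i j p w) }.

Definition smooth_map (f : M -> M) : Prop :=
  continuous f /\
  forall i j, smooth_on (cmap i @` (dom i `&` f @^-1` dom j))
                        (cmap j \o f \o cinv i).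

Record diffeo := Diffeo {
  fwd :> M -> M;
  bwd : M -> M;
  fwdK : cancel fwd bwd;
  bwdK : cancel bwd fwd;
  fwd_smooth : smooth_map fwd;
  bwd_smooth : smooth_map bwd }.

(* Time-dependent objects are functions of all t : R, of which only the values
   for t in [0,1] matter. *)
Definition I01 : set R := `[0, 1].

Definition smooth_isotopy (Phi : R -> diffeo) : Prop :=
  {within I01 `*` [set: M], continuous (fun z : R * M => Phi z.1 z.2)} /\
  forall i j,
    smooth_on [set z : R^o * 'rV[R]_m |
                 [/\ I01 z.1, img i z.2 & dom j (Phi z.1 (cinv i z.2))]]
              (fun z => cmap j (Phi z.1 (cinv i z.2))).

Definition smooth_hamiltonian (H : R -> M -> R) : Prop :=
  forall i, smooth_on [set z : R^o * 'rV[R]_m | I01 z.1 /\ img i z.2]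
                      (fun z => H z.1 (cinv i z.2) : R^o).

(* v is the velocity at time t, in the chart i, of a curve defined on [0,1];
   the derivative is one-sided for t = 0 and t = 1. *)
Definition velocity (c : R -> M) (t : R) i v : Prop :=
  (fun s => (s - t)^-1 *: (cmap i (c s) - cmap i (c t)))
    @ within I01 (t^') --> v.

Definition smooth_curve (c : R -> M) : Prop :=
  {within I01, continuous c} /\
  forall i, smooth_on [set t : R^o | I01 t /\ dom i (c t)]
                      (fun t => cmap i (c t)).

Definition curve_length (g : riemannian_metric) (c : R -> M) (l : R) : Prop :=
  exists2 s : R -> R,
    forall t i v, I01 t -> dom i (c t) -> velocity c t i v ->
      s t = Num.sqrt (gram (g i (c t)) v v) &
    l = (\int[lebesgue_measure]_(t in I01) s t)%R.

(* piecewise_smooth_path g p q l: there is a piecewise smooth path of length l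
   from p to q (each smooth piece being parametrized by [0,1]). *)
Inductive piecewise_smooth_path (g : riemannian_metric) :
    M -> M -> R -> Prop :=
| path_nil p : piecewise_smooth_path g p p 0
| path_cons (c : R -> M) q (l l' : R) :
    smooth_curve c -> curve_length g c l -> piecewise_smooth_path g (c 1) q l' ->
    piecewise_smooth_path g (c 0) q (l + l').

Definition riem_dist (g : riemannian_metric) p q : R :=
  inf [set l | piecewise_smooth_path g p q l].

Definition dbar (g : riemannian_metric) (f h : diffeo) : R :=
  sup (range (fun p => riem_dist g (f p) (h p))) +
  sup (range (fun p => riem_dist g (bwd f p) (bwd h p))).

Definition dbar_isotopy (g : riemannian_metric) (Phi Psi : R -> diffeo) : R :=
  sup [set dbar g (Phi t) (Psi t) | t in I01].

(* A finite continuous partition of unity subordinate to the charts. *)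
Record partition_of_unity := PartitionOfUnity {
  pou_size : nat;
  pou_chart : 'I_pou_size -> chart M;
  pou_fun : 'I_pou_size -> M -> R;
  pou_cont : forall k, continuous (pou_fun k);
  pou_ge0 : forall k p, 0 <= pou_fun k p;
  pou_supp : forall k,
    closure [set p | pou_fun k p != 0] `<=` dom (pou_chart k);
  pou_sum1 : forall p, \sum_k pou_fun k p = 1 }.

Lemma bump_exists p : exists (f : M -> R) i,
  [/\ continuous f, forall q, 0 <= f q, 0 < f p &
      closure [set q | f q != 0] `<=` dom i].
Proof.
have [i ip] := dom_cover p.
have nM := compact_normal (@carrier_hausdorff _ _ M) (@carrier_compact _ _ M).
have clD : closed (~` dom i) by exact/open_closedC/dom_open.
have aM := hausdorff_accessible (@carrier_hausdorff _ _ M).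
have /(_ (fun np => np ip)) sep := @normal_completely_regular R M nM aM p _ clD.
have [f [cf f01 f0 f1]] := (@uniform_separatorP _ R _ _).1 sep.
pose h q := Num.max 0 (2^-1 - f q).
exists h, i; split.
- move=> q; apply: (@continuous_max _ _ (fun=> 0) (fun q => 2^-1 - f q)).
    exact: cvg_cst.
  by apply: cvgB; [exact: cvg_cst|exact: cf].
- by move=> q; rewrite /h le_max lexx.
- by rewrite /h (_ : f p = 0) ?subr0 ?lt_max ?invr_gt0 ?ltr0n ?orbT//; apply: f0; exists p.
- have cl : closed (f @^-1` [set x | x <= 2^-1]).
    by apply: closed_comp => [q _|]; [exact: cf|exact: closed_le].
  apply: (@subset_trans _ (f @^-1` [set x | x <= 2^-1])).
    have /closure_id -> := cl; apply: closureS => q /=; apply: contra_neqT.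
    by rewrite -ltNge /h => lt; apply/max_idPl; rewrite subr_le0 ltW.
  move=> q /= fq; apply: contrapT => nq.
  have fq1 : f q = 1 by apply: f1; exists q.
  by move: fq; rewrite fq1 leNgt invf_lt1 ?ltr0n// ltr1n.
Qed.

Lemma partition_of_unity_exists : inhabited partition_of_unity.
Proof.
have [f /choice[ci fP]] := choice bump_exists.
pose F : set_system (seq M) :=
  filter_from setT (fun s : seq M => [set s' | {subset s <= s'}]).
have FF : Filter F.
  apply: filter_from_filter; first by exists [::].
  move=> s s' _ _; exists (s ++ s') => //= r sr.
  by split=> x xs; apply: sr; rewrite mem_cat xs ?orbT.
have PF : ProperFilter F.
  by apply: filter_from_proper => s _; exists s => /=.
have [|s] := @filter_ex _ F PF [set s | [set: M] `<=`
    [set x | exists2 y, y \in s & 0 < f y x]].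
  have /compact_near_coveringP := @carrier_compact _ _ M.
  move=> /(_ _ F (fun s x => exists2 y, y \in s & 0 < f y x) FF); apply.
  move=> x _; exists ([set x' | 0 < f x x'], [set s | x \in s]) => /=.
    split; last by exists [:: x] => //= s; apply; rewrite mem_head.
    have [cf _ f0 _] := fP x.
    exact: (cf x _ (open_nbhs_nbhs (conj (@open_gt R 0) f0))).
  by move=> [x' s] [/= fx xs]; exists x.
move=> sP; pose S p := \sum_(k < size s) f (tnth (in_tuple s) k) p.
have fge k p : 0 <= f k p by have [] := fP k.
have Sgt0 p : 0 < S p.
  have [y /(nthP y)[k ks <-] fy] := sP p I.
  rewrite /S (bigD1 (Ordinal ks))//= ltr_pwDl ?sumr_ge0//.
  by rewrite (tnth_nth y).
have cS : continuous S.
  rewrite /S; apply: continuous_big => [|k _]; first exact: add_continuous.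
  by have [] := fP (tnth (in_tuple s) k).
split; exists (size s) (fun k => ci (tnth (in_tuple s) k))
  (fun k p => f (tnth (in_tuple s) k) p / S p).
- move=> k p; have [cf _ _ _] := fP (tnth (in_tuple s) k).
  apply: cvgM; first exact: cf.
  by apply: cvgV; [exact: lt0r_neq0|exact: cS].
- by move=> k p; rewrite divr_ge0// ltW.
- move=> k; have [_ _ _] := fP (tnth (in_tuple s) k); apply: subset_trans.
  by apply: closureS => p /=; apply: contra_neq => ->; rewrite mul0r.
- by move=> p; rewrite -mulr_suml divff//; exact/lt0r_neq0/Sgt0.
Qed.

End Manifold.

Arguments one_form {R m} M.
Arguments vector_field {R m} M.
Arguments riemannian_metric {R m} M.
Arguments diffeo {R m} M.
Arguments partition_of_unity {R m} M.
Arguments pou_chart {R m M} p k : rename.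
Arguments pou_fun {R m M} p k q : rename.
Arguments I01 R : clear implicits.

Section ExteriorAlgebra.
Context {R : realType} {V : normedModType R}.

Definition multi_form (k : nat) := ('I_k -> V) -> R.

Definition wedge (k l : nat) (a : multi_form k) (b : multi_form l) :
    multi_form (k + l) :=
  fun v => (k`! * l`!)%:R^-1 *
    \sum_(s : 'S_(k + l)) (-1) ^+ s *
      a (fun i => v (s (lshift l i))) * b (fun j => v (s (rshift k j))).

Fixpoint wedge_pow (a : multi_form 2) (n : nat) : multi_form n.*2 :=
  match n with
  | 0%N => fun _ => 1
  | n'.+1 => wedge a (@wedge_pow a n')
  end.

End ExteriorAlgebra.

Arguments wedge_pow {R V} a n : rename.

(* Integral over R^m, as an iterated integral; it is only applied to
   continuous functions with compact support. *)
Fixpoint iter_integral (R : realType) (m : nat) : ('rV[R]_m -> R) -> R :=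
  match m with
  | 0%N => fun f => f 0
  | m'.+1 => fun f =>
      (\int[lebesgue_measure]_t
         iter_integral (fun y : 'rV[R]_m' => f (row_mx (t%:M : 'rV[R]_1) y)))%R
  end.

Section Contact.
Context {R : realType} {n : nat} {M : closed_manifold R n.*2.+1}.
Implicit Types (i j : chart M) (p : M) (v : 'rV[R]_n.*2.+1).

Definition one_form_multi (a : one_form M) i p :
    @multi_form R 'rV[R]_n.*2.+1 1 := fun u => pairing (a i p) (u ord0).

(* (da)(u_0, u_1) = u_0(a(u_1)) - u_1(a(u_0)) for constant vector fields u_0,
   u_1 in a chart. *)
Definition ext_deriv (a : one_form M) i p :
    @multi_form R 'rV[R]_n.*2.+1 2 := fun u =>
  'D_(u ord0) (fun x => pairing (a i (cinv i x)) (u ord_max) : R^o) (cmap i p) -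
  'D_(u ord_max) (fun x => pairing (a i (cinv i x)) (u ord0) : R^o) (cmap i p).

(* The coefficient of nu_a = a /\ (da)^n with respect to dx_0 /\ ... /\ dx_2n
   in the chart i. *)
Definition nu (a : one_form M) i p : R :=
  wedge (one_form_multi a i p) (wedge_pow (ext_deriv a i p) n)
    (fun k => delta_mx 0 k).

Definition contact_form (a : one_form M) : Prop :=
  forall i p, dom i p -> nu a i p != 0.

Definition is_reeb (a : one_form M) (X : vector_field M) : Prop :=
  forall i p, dom i p ->
    pairing (a i p) (X i p) = 1 /\
    forall v, ext_deriv a i p (fun k => if k == ord0 then X i p else v) = 0.

(* The integral of f nu_a, M being oriented by nu_a (whence the absolute value
   in charts that may reverse the orientation). As usual it does not depend on
   the partition of unity. *)
Definition integral_nu (a : one_form M) (P : partition_of_unity M)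
    (f : M -> R) : R :=
  \sum_k let i := pou_chart P k in
    iter_integral ((fun x => let p := cinv i x in
      pou_fun P k p * f p * `|nu a i p|) \_ (img i)).

Definition ham_norm (a : one_form M) (P : partition_of_unity M)
    (h : M -> R) : R :=
  sup (range h) - inf (range h) +
  `| (integral_nu a P (fun=> 1))^-1 * integral_nu a P h |.

Definition norm_1oo (a : one_form M) (P : partition_of_unity M)
    (H : R -> M -> R) : R :=
  (\int[lebesgue_measure]_(t in I01 R) ham_norm a P (H t))%R.

Definition norm_oo (a : one_form M) (P : partition_of_unity M)
    (H : R -> M -> R) : R :=
  sup [set ham_norm a P (H t) | t in I01 R].

Definition basic (Rb : vector_field M) (H : R -> M -> R) : Prop :=
  forall t i p, I01 R t -> dom i p ->
    'd (fun x => H t (cinv i x) : R^o) (cmap i p) (Rb i p) = 0.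

Definition preserves (a : one_form M) (f : M -> M) : Prop :=
  forall i j p v, dom i p -> dom j (f p) ->
    pairing (a j (f p)) ('d (cmap j \o f \o cinv i) (cmap i p) v) = pairing (a i p) v.

Definition strictly_contact_isotopy (a : one_form M) (Phi : R -> diffeo M) :
    Prop :=
  smooth_isotopy Phi /\ forall t, I01 R t -> preserves a (Phi t).

Definition generates (a : one_form M) (H : R -> M -> R) (Phi : R -> diffeo M) :
    Prop :=
  exists2 X : R -> vector_field M,
    forall t i p, I01 R t -> dom i (Phi t p) ->
      velocity (fun s => Phi s p) t i (X t i (Phi t p)) &
    forall t i p, I01 R t -> dom i p -> H t p = pairing (a i p) (X t i p).

End Contact.

(* Main.v *)
(** If [zeta] is an increasing reparametrisation of [0,1], the isotopy
    [t |-> PhiH (zeta t)] is generated by [F t = zeta' t * H (zeta t)], so that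
    [||F t|| = zeta' t * ||H (zeta t)||].  The function [h t = ||H t||] is
    continuous; choose a polynomial [p > 0] with [h <= p <= h + eps/2] on [0,1],
    put [c = int_0^1 p], and let [zeta] be the inverse of
    [s |-> c^-1 * int_0^s p].  Then [zeta' = c / p(zeta)], whence
    [||F t|| <= c <= ||H||_(1,oo) + eps/2] for every [t].  As [zeta] maps [0,1]
    onto [0,1] and fixes the end points, the two distances in (iii) are equal. *)

From HB Require Import structures.
Require Import Defs.
From mathcomp Require Import all_boot all_order all_algebra.
From mathcomp Require Import all_classical all_reals all_analysis.
From mathcomp Require Import lra.
Import Order.TTheory GRing.Theory Num.Theory.
Import numFieldNormedType.Exports.
Set Implicit Arguments.
Unset Strict Implicit.
Local Open Scope classical_set_scope.
Local Open Scope ring_scope.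

(** * Polynomial majorants and the change of time *)

(** The norm [h] is merely continuous in time, because the maximum and minimum over [M] need not
    vary smoothly, and it may vanish; it therefore cannot itself be the density of a smooth change
    of time. A polynomial that is bounded below by a positive constant on the whole line can: [zeta]
    is then a bijection of [R], differentiable on both sides of 0 and 1, so smoothness up to the end
    points is inherited from the local extensions of [H] and [PhiH]. Describing [zeta] through its
    inverse gives an autonomous equation for [zeta], from which smoothness follows by induction on
    the order. The continuity of [h] rests on a Lipschitz bound for [ham_norm] in the uniform norm;
    its mean term is a sum of iterated integrals over charts, so continuity, compact support and a
    bounded density have to be established there. *)

Section Bernstein.
Context {R : realType}.
Implicit Types (u v : nat -> R) (x : R).

(* [(bernstein N u).[x]] is the expectation of [u S_N], [S_N] binomial with
   parameters [N] and [x]; the recursion conditions on one Bernoulli trial. *)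
Fixpoint bernstein (N : nat) u : {poly R} :=
  match N with
  | 0%N => (u 0%N)%:P
  | N'.+1 => 'X * bernstein N' (u \o S) + (1 - 'X) * bernstein N' u
  end.

Lemma bernstein_combination N (a b : R) u v x :
  (bernstein N (fun i => a * u i + b * v i)).[x] =
  a * (bernstein N u).[x] + b * (bernstein N v).[x].
Proof.
elim: N u v => [|N ih] u v /=; first by rewrite !hornerE.
rewrite [LHS]hornerE /= !hornerM.
rewrite [_ \o S](_ : _ = fun i => a * (u \o S) i + b * (v \o S) i)//.
by rewrite !ih !hornerE; lra.
Qed.

(** For [x] in [0,1] each step of the recursion is a convex combination. This positivity and the
    moments of order at most two are all that the approximation argument uses. *)
Lemma ler_bernstein N u v x : 0 <= x <= 1 ->
  (forall i, (i <= N)%N -> u i <= v i) ->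
  (bernstein N u).[x] <= (bernstein N v).[x].
Proof.
move=> /andP[x0 x1]; elim: N u v => [|N ih] u v uv /=.
  by rewrite !hornerE; exact: uv.
rewrite !hornerE; apply: lerD.
- by apply: ler_wpM2l => //; apply: ih => i iN; exact: uv.
- apply: ler_wpM2l; first by rewrite subr_ge0.
  by apply: ih => i iN; apply: uv; rewrite ltnW.
Qed.

Lemma bernstein_cst N (c : R) x : (bernstein N (fun=> c)).[x] = c.
Proof.
elim: N => [|N ih] /=; first by rewrite hornerE.
by rewrite !hornerE [_ \o S](_ : _ = fun=> c)// ih; lra.
Qed.

Lemma bernstein_id N x : (bernstein N (fun i => i%:R)).[x] = N%:R * x.
Proof.
elim: N => [|N ih] /=; first by rewrite hornerE mul0r.
rewrite !hornerE.
rewrite [_ \o S](_ : _ = fun i => 1 * i%:R + 1 * 1); last first.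
  by apply/funext => i /=; rewrite !mul1r -natr1.
rewrite (bernstein_combination N 1 1 (fun i => i%:R) (fun=> 1)).
by rewrite bernstein_cst ih -natr1; lra.
Qed.

Lemma bernstein_sqr N x :
  (bernstein N (fun i => i%:R ^+ 2)).[x] = N%:R * x * (1 - x) + (N%:R * x) ^+ 2.
Proof.
elim: N => [|N ih] /=; first by rewrite hornerE /=; lra.
rewrite !hornerE.
rewrite [_ \o S](_ : _ = fun i => 1 * i%:R ^+ 2 + 1 * (2 * i%:R + 1 * 1)).
  rewrite (bernstein_combination N 1 1 (fun i => i%:R ^+ 2)).
  rewrite (bernstein_combination N 2 1 (fun i => i%:R) (fun=> 1)).
  by rewrite bernstein_cst bernstein_id ih -natr1; lra.
by apply/funext => i /=; rewrite -natr1; lra.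
Qed.

Lemma bernstein_variance N x : (0 < N)%N ->
  (bernstein N (fun i => (i%:R / N%:R - x) ^+ 2)).[x] = x * (1 - x) / N%:R.
Proof.
move=> N0; have N0' : N%:R != 0 :> R by rewrite pnatr_eq0 -lt0n.
have := mulfV N0'; set z := N%:R^-1 => Nz.
rewrite [X in bernstein _ X](_ : _ = fun i => z ^+ 2 * i%:R ^+ 2 +
   1 * ((- 2 * x * z) * i%:R + x ^+ 2 * 1)); last first.
  by apply/funext => i; lra.
rewrite (bernstein_combination N _ _ (fun i => i%:R ^+ 2)).
rewrite (bernstein_combination N _ _ (fun i => i%:R) (fun=> 1)).
rewrite bernstein_cst bernstein_id bernstein_sqr.
(* Grouping each [N] with a factor [z] lets the relation [Nz] be used by rewriting; what remains is
   a linear identity between monomials. *)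
transitivity (z * (N%:R * z) * x * (1 - x) + (N%:R * z) ^+ 2 * x ^+ 2
  - 2 * x ^+ 2 * (N%:R * z) + x ^+ 2); first by lra.
by rewrite Nz; lra.
Qed.

(** The quadratic error term is chosen so that applying [bernstein] to it produces exactly the
    variance; no separate treatment of nodes far from [x] is then needed. *)
Lemma quadratic_modulus_of_continuity (f : R -> R) (e : R) :
  {within `[0, 1], continuous f} -> 0 < e ->
  exists2 K, 0 < K & forall x y, 0 <= x <= 1 -> 0 <= y <= 1 ->
    `|f x - f y| <= e + K * (x - y) ^+ 2.
Proof.
move=> cf e0.
have [B [_ /= Bf]] := compact_bounded (continuous_compact cf (@segment_compact R 0 1)).
have {Bf} : exists2 B, 0 < B & forall x, 0 <= x <= 1 -> `|f x| <= B.
  exists (`|B| + 1); first by rewrite ltr_wpDl.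
  move=> x x01; apply: Bf; last by exists x => //=; rewrite in_itv.
  by rewrite (le_lt_trans (ler_norm _))// ltrDl.
move=> {B} [B B0 Bf].
have [d d0 df] : exists2 d, 0 < d & forall x y, 0 <= x <= 1 -> 0 <= y <= 1 ->
    `|x - y| < d -> `|f x - f y| <= e.
  have cpt : compact (`[0, 1]%classic : set R) by exact: segment_compact.
  (* Uniform continuity by compactness: a local radius [r] at [x] is halved, so that both [x'] and
     every [y] within [d < r / 2] of [x'] lie in the ball of radius [r] about [x]. *)
  move/compact_near_coveringP : cpt => /(_ R (0^'+)
    (fun d x => 0 <= x <= 1 -> forall y, 0 <= y <= 1 -> `|x - y| < d ->
       `|f x - f y| <= e) _) nc.
  have : \forall d \near 0^'+, `[0, 1]%classic `<=`
    (fun x => 0 <= x <= 1 -> forall y, 0 <= y <= 1 -> `|x - y| < d ->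
       `|f x - f y| <= e).
    apply: nc => x x01.
    have /subspace_continuousP/(_ x x01) := cf.
    move=> /cvgrPdist_lt /(_ (e / 2) ltac:(lra)).
    rewrite near_withinE => /nbhs_ballP[r /= r0 rf].
    exists (ball x (r / 2), [set d | d < r / 2]); first split => /=.
    + by apply: nbhsx_ballx; lra.
    + by apply: nbhs_right_lt; lra.
    move=> [x' d] [/= xx' dr] x'01 y y01 x'y.
    have h1 : `|f x - f x'| < e / 2.
      by apply: rf; rewrite ?in_itv//= /ball /= in xx' *; apply: lt_le_trans xx' _; lra.
    have h2 : `|f x - f y| < e / 2.
      apply: rf; rewrite /= ?in_itv// /ball /= in xx' *.
      by have := ler_distD x' x y; lra.
    by have := ler_distD (f x) (f x') (f y); rewrite (distrC (f x') (f x)); lra.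
  move=> H; have [d [d0 dH]] : exists d, 0 < d /\ (`[0, 1]%classic `<=`
    (fun x => 0 <= x <= 1 -> forall y, 0 <= y <= 1 -> `|x - y| < d ->
       `|f x - f y| <= e)).
    apply: (@filter_ex _ (0^'+ : set_system R)).
    by near=> d; split; near: d => //; exact: nbhs_right_gt.
  exists d => // x y x01 y01 xy; apply: (dH x _ x01 y y01 xy).
  by rewrite /= in_itv.
(* When [x] and [y] are at least [d] apart, the quadratic term alone exceeds [2 * B], the largest
   possible oscillation of [f]. *)
exists (2 * B / d ^+ 2); first by rewrite divr_gt0 ?exprn_gt0// mulr_gt0.
move=> x y x01 y01; have [xy|xy] := ltP `|x - y| d.
  apply: (le_trans (df _ _ x01 y01 xy)).
  by rewrite lerDl mulr_ge0 ?sqr_ge0// divr_ge0 ?sqr_ge0// mulr_ge0// ltW.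
have : 2 * B <= 2 * B / d ^+ 2 * (x - y) ^+ 2.
  rewrite -mulrA ler_pMr ?mulr_gt0// mulrC ler_pdivlMr ?exprn_gt0// mul1r.
  by rewrite -(real_normK (num_real (x - y))) ler_sqr ?nnegrE// ltW.
have := ler_normB (f x) (f y); have := Bf _ x01; have := Bf _ y01.
by lra.
Unshelve. all: by end_near. Qed.

Lemma weierstrass_approximation (f : R -> R) (e : R) :
  {within `[0, 1], continuous f} -> 0 < e ->
  exists p : {poly R}, forall x, 0 <= x <= 1 -> `|p.[x] - f x| <= e.
Proof.
move=> cf e0; have [K K0 Kf] := quadratic_modulus_of_continuity cf (divr_gt0 e0 (ltr0Sn R 1)).
(* The variance is at most [1 / N], so this [N] makes its contribution at most [e / 2]. *)
set N := (Num.truncn (2 * K / e)).+1.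
have NK : 2 * K / e < N%:R by exact: truncnS_gt.
exists (bernstein N (fun i => f (i%:R / N%:R))) => x /[dup] x01 /andP[x0 x1].
have N0 : 0 < N%:R :> R by rewrite ltr0n.
have iN i : (i <= N)%N -> 0 <= (i%:R / N%:R : R) <= 1.
  move=> iN; rewrite divr_ge0//=.
  by rewrite ler_pdivrMr// mul1r ler_nat.
have bnd : e / 2 + K * (x * (1 - x) / N%:R) <= e.
  have : K * (x * (1 - x) / N%:R) <= e / 2.
    rewrite mulrA ler_pdivrMr//.
    apply: (@le_trans _ _ (K * 1)); first by apply: ler_wpM2l; nra.
    by move: NK; rewrite ltr_pdivrMr//; lra.
  by lra.
(* The sign [s] covers both one-sided bounds. Everything is written as a value of [bernstein], so
   that positivity reduces the claim to the quadratic modulus at the nodes [i / N]. *)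
have main s : (s = 1 \/ s = -1) ->
    s * ((bernstein N (fun i => f (i%:R / N%:R))).[x] - f x) <= e.
  move=> s1; apply: le_trans bnd.
  rewrite -(bernstein_variance x (ltn0Sn _)) -/N.
  rewrite -[X in _ <= X + _](bernstein_cst N _ x) -[X in _ <= X + _]mul1r.
  rewrite -bernstein_combination.
  rewrite -[X in _ - X](bernstein_cst N _ x) mulrBr -mulNr -bernstein_combination.
  apply: ler_bernstein => // i /iN iN01.
  have := Kf _ _ iN01 x01; rewrite ler_norml => /andP[].
  by case: s1 => ->; lra.
rewrite ler_norml; have := main 1 (or_introl erefl); have := main (-1) (or_intror erefl).
by lra.
Qed.

(** Approximating the square root of [f] and squaring gives a polynomial that is nonnegative on all
    of [R], not only on [0,1]; adding a constant [k] makes it a majorant and bounds it away from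
    0. *)
Lemma polynomial_majorant (f : R -> R) (e : R) :
  {within `[0, 1], continuous f} -> (forall x, 0 <= x <= 1 -> 0 <= f x) ->
  0 < e ->
  exists2 p : {poly R}, exists2 k, 0 < k & forall x, k <= p.[x] &
    forall x, 0 <= x <= 1 -> f x <= p.[x] <= f x + e.
Proof.
move=> cf f0 e0.
have csf : {within `[0, 1], continuous (Num.sqrt \o f)}.
  apply/subspace_continuousP => x x01; apply: cvg_comp; last exact: sqrt_continuous.
  by move/subspace_continuousP : cf; exact.
have [B [_ /= Bf]] := compact_bounded (continuous_compact csf (@segment_compact R 0 1)).
have {Bf} : exists2 B, 0 < B & forall x, 0 <= x <= 1 -> `|Num.sqrt (f x)| <= B.
  exists (`|B| + 1); first by rewrite ltr_wpDl.
  move=> x x01; apply: Bf; last by exists x => //=; rewrite in_itv.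
  by rewrite (le_lt_trans (ler_norm _))// ltrDl.
move=> {B} [B B0 Bf].
(* With [q] within [d] of [s], [0 <= s <= B] and [d <= 1], the squares differ by at most
   [k = d * (2 * B + 1)]. After the shift by [k] the total excess is at most [2 * k], which this [d]
   keeps below [e]. *)
pose d := Num.min 1 (e / (4 * B + 2)).
have d0 : 0 < d by rewrite lt_min ltr01/= divr_gt0//; lra.
have d1 : d <= 1 by rewrite ge_min lexx.
have de : d * (4 * B + 2) <= e.
  by rewrite -ler_pdivlMr; [rewrite ge_min lexx orbT|lra].
have [p pf] := weierstrass_approximation csf d0.
pose k := d * (2 * B + 1).
have k0 : 0 < k by rewrite mulr_gt0//; lra.
exists (p ^+ 2 + k%:P); first by exists k => // x; rewrite !hornerE lerDr sqr_ge0.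
move=> x x01; have := pf x x01; have := Bf x x01; rewrite !hornerE /= ger0_norm//.
have -> : f x = Num.sqrt (f x) ^+ 2 by rewrite sqr_sqrtr// f0.
rewrite ?expr2 sqrtr_sqr ger0_norm ?sqrtr_ge0 // /k.
set s := Num.sqrt (f x); have : 0 <= s by exact: sqrtr_ge0.
rewrite ler_norml; set q := p.[x] => s0 sB /andP[h1 h2].
have : `|(q - s) * (q + s)| <= d * (2 * B + 1).
  rewrite normrM ler_pM//; first by rewrite ler_norml; lra.
  by rewrite ler_norml; lra.
by rewrite ler_norml => /andP[h3 h4]; apply/andP; split; nra.
Qed.

End Bernstein.

(** * Primitives of polynomials and their inverses *)

Section TimeChange.
Context {R : realType}.
Implicit Types (p : {poly R}) (x : R).

Definition antideriv (p : {poly R}) : {poly R} :=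
  \poly_(i < (size p).+1) (p`_i.-1 / i%:R).

Lemma deriv_antideriv p : (antideriv p)^`() = p.
Proof.
apply/polyP => i; rewrite coef_deriv coef_poly ltnS /=.
case: ltnP => [ip|pi]; last by rewrite mul0rn nth_default.
by rewrite -[LHS]mulr_natr divfK// pnatr_eq0.
Qed.

Lemma antideriv0 p : (antideriv p).[0] = 0.
Proof. by rewrite horner_coef0 coef_poly /= invr0 mulr0. Qed.

Lemma is_derive_antideriv p x : is_derive x 1 (horner (antideriv p)) p.[x].
Proof.
apply: DeriveDef; first exact: derivable_horner.
by rewrite -derive1E -[X in _ = horner X _](deriv_antideriv p) derivE.
Qed.

Lemma Rintegral_antideriv p :
  (\int[lebesgue_measure]_(x in `[0%R, 1%R]) p.[x])%R = (antideriv p).[1].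
Proof.
rewrite /Rintegral (@continuous_FTC2 _ _ (horner (antideriv p))) ?ltr01//.
- by rewrite antideriv0 sube0.
- by apply: continuous_subspaceT; exact: continuous_horner.
- split.
  + by move=> x _; exact: derivable_horner.
  + by apply: cvg_at_right_filter; exact: continuous_horner.
  + by apply: cvg_at_left_filter; exact: continuous_horner.
- by move=> x _; rewrite -derivE deriv_antideriv.
Qed.

(** The bound [k] holds on the whole line, so the primitive [Q] has slope at least [k] everywhere
    and is a bijection of [R]; [zeta t] is the point where [Q] equals [c * t]. *)
Lemma time_change (p : {poly R}) (k : R) : 0 < k -> (forall x, k <= p.[x]) ->
  0 < (antideriv p).[1] /\ exists zeta : R -> R,
    [/\ zeta 0 = 0, zeta 1 = 1, {homo zeta : s t / s < t},
        (forall s, exists t, zeta t = s) &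
        forall t : R, is_derive t 1 zeta ((antideriv p).[1] / p.[zeta t])].
Proof.
move=> k0 kp; set Q := horner (antideriv p).
have dQ (x : R) : is_derive x 1 Q p.[x] := is_derive_antideriv p x.
have Q_incr x y : x < y -> k * (y - x) <= Q y - Q x.
  move=> xy; have [//|c _ ->] := @MVT _ Q (horner p) _ _ xy.
    by apply: continuous_subspaceT; exact: continuous_horner.
  by rewrite ler_wpM2r ?subr_ge0 ?kp// ltW.
have Q_mono x y : x < y -> Q x < Q y.
  by move=> xy; have := Q_incr _ _ xy; rewrite -[_ < _]subr_gt0 => /(lt_le_trans _);
    apply; rewrite mulr_gt0// subr_gt0.
have Q0 : Q 0 = 0 := antideriv0 p.
set c := Q 1; have c0 : 0 < c by rewrite -Q0 Q_mono.
have Qinj : injective Q.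
  move=> x y Qxy; have [/Q_mono|/Q_mono|//] := ltgtP x y; by rewrite Qxy ltxx.
have Qsurj y : exists x, Q x = y.
  (* By the slope bound, [Q] is at least [|y| + k] at [A + 1] and at most the opposite value at
     [- (A + 1)], so [y] lies in between. *)
  pose A := `|y| / k.
  have A0 : 0 <= A by rewrite divr_ge0// ltW.
  have QA : y <= Q (A + 1).
    have := Q_incr 0 (A + 1) ltac:(lra); rewrite Q0 !subr0; apply: le_trans.
    by rewrite mulrDr mulrCA divff ?gt_eqF// mulr1; have := ler_norm y; lra.
  have QB : Q (- (A + 1)) <= y.
    have := Q_incr (- (A + 1)) 0 ltac:(lra); rewrite Q0 sub0r opprK => h.
    have : k * (A + 1) = `|y| + k by rewrite mulrDr mulrCA divff ?gt_eqF// !mulr1.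
    by have := ler_norm (- y); rewrite normrN; lra.
  have [||x _ <-] := @IVT _ Q (- (A + 1)) (A + 1) y ltac:(lra).
  - by apply: continuous_subspaceT; exact: continuous_horner.
  - by rewrite ge_min QB le_max QA orbT.
  by exists x.
have [zeta zetaP] := choice (fun t => Qsurj (c * t)).
have zetaK s : zeta (Q s / c) = s.
  by apply: Qinj; rewrite zetaP mulrC divfK// gt_eqF.
split=> //; exists zeta; split.
- by rewrite -[LHS](congr1 zeta (mul0r c^-1)) -{1}Q0 zetaK.
- by rewrite -[RHS]zetaK -/c divff// gt_eqF.
- move=> s t st; rewrite ltNge; apply/negP; rewrite le_eqVlt => /orP[/eqP e|/Q_mono].
    by have := zetaP t; rewrite e zetaP => /(mulfI (lt0r_neq0 c0)) ts; rewrite ts ltxx in st.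
  by rewrite !zetaP ltr_pM2l// ltNge (ltW st).
- by move=> s; exists (Q s / c).
(* Writing [t] as [Q x / c] puts the goal in the form required by the derivative of an inverse
   function. *)
- move=> t; have [x <-] : exists x, Q x / c = t.
    by exists (zeta t); rewrite zetaP mulrC mulKf// gt_eqF.
  rewrite zetaK -[X in is_derive _ _ _ X]invrK invf_div.
  apply: (@is_derive_inverse _ (fun x => Q x / c) zeta).
  + by near=> y; exact: zetaK.
  + near=> y; apply: cvgM; last exact: cvg_cst.
    exact: continuous_horner.
  + rewrite (_ : (fun x => Q x / c) = c^-1 *: Q); last first.
      by apply/funext => y; rewrite mulrC.
    by apply: is_derive_eq; exact: mulrC.
  + by rewrite mulf_neq0 ?invr_neq0// gt_eqF// (lt_le_trans k0).
Unshelve. all: by end_near. Qed.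

End TimeChange.

(** * Calculus of C^k functions *)

Section ScaleBilinear.
Context {R : realType} {W : normedModType R}.

Lemma scale_is_bilinear : bilinear_for
  (GRing.Scale.Law.clone _ _ *:%R _) (GRing.Scale.Law.clone _ _ *:%R _)
  (@GRing.scale R W : R^o -> W -> W).
Proof.
split=> [w|a] b x y /=; first by rewrite scalerDl scalerA.
by rewrite scalerDr !scalerA mulrC.
Qed.

HB.instance Definition _ := bilinear_isBilinear.Build R R^o W W _ _
  (@GRing.scale R W : R^o -> W -> W) scale_is_bilinear.

End ScaleBilinear.

Section NearEqDifferentiable.
Context {R : numFieldType} {V W : normedModType R}.
Implicit Types f g : V -> W.

(** The expansion of [f] at [x] up to a little-o is also one for [g], and such an expansion
    determines the differential. *)
Lemma near_eq_diff f g x :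
  (\near x, f x = g x) -> differentiable f x ->
  differentiable g x /\ 'd g x = 'd f x :> (V -> W).
Proof.
move=> fg /diff_locallyP[cd E].
have E' : g \o shift x = cst (g x) + 'd f x +o_ 0 id.
  apply/eqaddoP => e e0; move/eqaddoP : E => /(_ e e0).
  have : \forall h \near (0 : V), f (h + x) = g (h + x).
    by rewrite (near_shift x) sub0r; near do rewrite /= subrK.
  apply: filterS2 => h /= Eh.
  by rewrite !fctE /= in Eh *; rewrite Eh (nbhs_singleton fg).
have dg : 'd g x = 'd f x :> (V -> W) by exact: diff_unique.
by split => //; apply/diff_locallyP; rewrite dg.
Unshelve. all: by end_near. Qed.

End NearEqDifferentiable.

Section Ck.
Context {R : realType} {V W : normedModType R}.
Implicit Types (f g : V -> W) (U : set V) (k : nat).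

Lemma Ck_ext k U f g : open U -> (forall x, U x -> f x = g x) ->
  Ck k U f -> Ck k U g.
Proof.
move=> oU; elim: k f g => [|k ih] f g fg /=.
  move=> cf x Ux; rewrite /prop_for /continuous_at /= -(fg x Ux).
  apply: cvg_trans (cf x Ux).
  apply: near_eq_cvg; have := open_nbhs_nbhs (conj oU Ux).
  by apply: filterS => y /fg.
have nfg x : U x -> \near x, f x = g x.
  by move=> Ux; have := open_nbhs_nbhs (conj oU Ux); apply: filterS => y /fg.
move=> [df Df]; split => [x Ux|v].
  by have [] := near_eq_diff (nfg _ Ux) (df x Ux).
by apply: ih (Df v) => x Ux; apply: near_eq_derive; exact: nfg.
Qed.

Lemma CkW k U f : Ck k.+1 U f -> Ck k U f.
Proof.
elim: k f => [|k ih] f /= [df Df]; first by move=> x /df/differentiable_continuous.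
by split => // v; apply: ih (Df v).
Qed.

Lemma Ck_subset k U U' f : U' `<=` U -> Ck k U f -> Ck k U' f.
Proof.
move=> UU'; elim: k f => [|k ih] f /=; first by move=> cf x /UU'; exact: cf.
by move=> [df Df]; split => [x /UU'|v]; [exact: df|exact: ih (Df v)].
Qed.

Lemma CkD k U f g : open U -> Ck k U f -> Ck k U g -> Ck k U (fun x => f x + g x).
Proof.
move=> oU; elim: k f g => [|k ih] f g /=.
  by move=> cf cg x Ux; apply: cvgD; [exact: cf|exact: cg].
move=> [df Df] [dg Dg]; split => [x Ux|v].
  by apply: differentiableD; [exact: df|exact: dg].
apply: (@Ck_ext _ _ (fun x => 'D_v f x + 'D_v g x)) => //; last exact: ih.
by move=> x Ux; rewrite -[RHS]/('D_v (f + g) x) deriveD//; apply: diff_derivable;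
  [exact: df|exact: dg].
Qed.

Lemma is_diff_scale (a : V -> R^o) f x : differentiable a x -> differentiable f x ->
  is_diff x (fun z => a z *: f z) (fun v => 'd a x v *: f x + a x *: 'd f x v).
Proof.
move=> da df.
have sc : continuous (fun p : R^o * W => p.1 *: p.2) by exact: scale_continuous.
have ds : differentiable (fun p : R^o * W => p.1 *: p.2) (a x, f x).
  exact: differentiable_bilin.
have dp : differentiable (fun z => (a z, f z)) x by exact: differentiable_pair.
have -> : (fun z => a z *: f z) =
  (fun p : R^o * W => p.1 *: p.2) \o (fun z => (a z, f z)) by [].
apply: DiffDef; first exact: differentiable_comp.
by rewrite diff_comp// diff_pair// diff_bilin//; apply/funext => v /=; rewrite addrC.
Qed.

End Ck.

Section CkScale.
Context {R : realType} {V W : normedModType R}.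
Implicit Types (f : V -> W) (a : V -> R^o) (U : set V) (k : nat).

Lemma CkZ k U a f : open U -> Ck k U a -> Ck k U f -> Ck k U (fun x => a x *: f x).
Proof.
move=> oU; elim: k a f => [|k ih] a f /=.
  by move=> ca cf x Ux; apply: cvgZ; [exact: ca|exact: cf].
move=> Ca Cf; have [da Da] := Ca; have [df Df] := Cf.
split => [x Ux|v].
  by have [] := is_diff_scale (da x Ux) (df x Ux).
apply: (@Ck_ext _ _ _ _ _ (fun x => 'D_v a x *: f x + a x *: 'D_v f x)) => //.
  move=> x Ux; have [dx dE] := is_diff_scale (da x Ux) (df x Ux).
  by rewrite [RHS]deriveE// dE !deriveE//; [exact: df|exact: da].
by apply: CkD => //; apply: ih => //; exact: CkW.
Qed.

Lemma Ck_cst k U (w : W) : Ck k U (fun=> w : W).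
Proof.
elim: k w => [|k ih] w /=; first by move=> x _; exact: cvg_cst.
split=> [x _|v]; first exact: differentiable_cst.
by rewrite (_ : 'D_v _ = fun=> 0)//; apply/funext => x; exact: derive_cst.
Qed.

End CkScale.

Lemma CkV (R : realType) (V : normedModType R) k (U : set V) (q : V -> R^o) :
  open U -> (forall x, U x -> q x != 0) -> Ck k U q ->
  Ck k U (fun x => (q x)^-1 : R^o).
Proof.
move=> oU q0; elim: k => [|k ih] /=.
  by move=> cq x Ux; apply: cvgV; [exact: q0|exact: cq].
move=> Cq; have [dq Dq] := Cq.
have {}ih : Ck k U (fun x => (q x)^-1 : R^o) by apply: ih; exact: CkW.
split => [x Ux|v]; first by apply: differentiableV; [exact: dq|exact: q0].
(* The derivative of the inverse is arranged as a product of functions already known to be of class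
   [k], so that [CkZ] and the induction hypothesis apply. *)
apply: (@Ck_ext _ _ _ _ _ (fun x => (q x)^-1 *: ((q x)^-1 *: (-1 *: 'D_v q x)))) => //.
  move=> x Ux; rewrite [RHS](@deriveV _ _ q)//; last first.
  - by apply: diff_derivable; exact: dq.
  - exact: q0.
  rewrite /GRing.scale /= -exprVn; lra.
apply: CkZ => //; apply: CkZ => //; apply: CkZ => //.
exact: Ck_cst.
Qed.

Section TimeReparametrisation.
Context {R : realType} {V W : normedModType R}.

Lemma Ck_horner_fst k U (p : {poly R}) :
  Ck k U (fun z : R^o * V => p.[z.1] : R^o).
Proof.
have dp (q : {poly R}) z :
    is_diff z (fun z : R^o * V => q.[z.1] : R^o) (fun v => v.1 * q^`().[z.1]).
  have dh : differentiable (horner q : R^o -> R^o) z.1.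
    by apply/derivable1_diffP; exact: derivable_horner.
  have df : differentiable (fst : R^o * V -> R^o) z.
    by apply: linear_differentiable => ?; exact: cvg_fst.
  apply: DiffDef; first exact: (@differentiable_comp _ _ _ _ fst (horner q)).
  rewrite (@diff_comp _ _ _ _ fst (horner q))//; apply/funext => v /=.
  rewrite deriv1E; last exact: derivable_horner.
  rewrite -derivE (@diff_lin _ _ _ fst)//.
  by move=> ?; exact: cvg_fst.
elim: k p => [|k ih] p /=.
  by move=> x _; apply/differentiable_continuous; have [] := dp p x.
split => [x _|v]; first by have [] := dp p x.
have -> : 'D_v (fun z : R^o * V => p.[z.1] : R^o) = (fun z => (v.1 *: p^`()).[z.1]).
  by apply/funext => z; have [dz dE] := dp p z; rewrite deriveE// dE hornerZ.
exact: ih.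
Qed.

Variables (zeta : R -> R) (p c : {poly R}).
Hypothesis p0 : forall x, p.[x] != 0.
Hypothesis dzeta : forall t : R, is_derive t 1 zeta (c.[zeta t] / p.[zeta t]).

Let psi (z : R^o * V) : R^o * V := (zeta z.1, z.2).
(** A function of the new time: the derivative of [zeta] at [z.1] is [speed (psi z)]. *)
Let speed (z : R^o * V) : R^o := c.[z.1] / p.[z.1].

Let diff_psi z : is_diff z psi (fun v => (v.1 * speed (psi z), v.2)).
Proof.
have d1 : differentiable (fst : R^o * V -> R^o) z.
  by apply: linear_differentiable => ?; exact: cvg_fst.
have d2 : differentiable (snd : R^o * V -> V) z.
  by apply: linear_differentiable => ?; exact: cvg_snd.
have dz : differentiable (zeta : R^o -> R^o) z.1.
  by apply/derivable1_diffP; exact: ex_derive.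
have dz1 : differentiable (zeta \o fst : R^o * V -> R^o) z.
  exact: differentiable_comp.
apply: DiffDef; first exact: differentiable_pair.
rewrite diff_pair//; apply/funext => v /=.
rewrite (@diff_comp _ _ _ _ fst zeta)//= deriv1E; last exact: ex_derive.
rewrite derive1E derive_val (@diff_lin _ _ _ fst); last by move=> ?; exact: cvg_fst.
by rewrite (@diff_lin _ _ _ snd)//; move=> ?; exact: cvg_snd.
Qed.

Lemma Ck_speed k U : open U -> Ck k U speed.
Proof.
move=> oU; rewrite (_ : speed = fun z => c.[z.1] *: (p.[z.1])^-1)//.
apply: CkZ => //; first exact: Ck_horner_fst.
by apply: CkV => //; exact: Ck_horner_fst.
Qed.

Let continuous_psi : continuous psi.
Proof. by move=> z; apply: differentiable_continuous; have [] := diff_psi z. Qed.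

(* Since [zeta'] is a function of [zeta], a directional derivative of [f \o psi]
   is again of the form [f1 \o psi], which makes the induction on [k] work. *)
Lemma Ck_reparam k U (f : R^o * V -> W) : open U -> Ck k U f ->
  Ck k (psi @^-1` U) (f \o psi).
Proof.
move=> oU; have oV : open (psi @^-1` U) by move/continuousP : continuous_psi; exact.
elim: k f => [|k ih] f /=.
  move=> cf z Uz; apply: continuous_comp; first exact: continuous_psi.
  exact: cf.
move=> [df Df]; split => [z Uz|v].
  by apply: differentiable_comp; [have [] := diff_psi z|exact: df].
pose f1 z := (v.1 * speed z) *: 'D_(1, 0) f z + 'D_(0, v.2) f z.
apply: (@Ck_ext _ _ _ _ _ (f1 \o psi)) => //.
  move=> z Uz; have [dz dE] := diff_psi z; have dfz := df _ Uz.
  rewrite [RHS]deriveE; last exact: differentiable_comp.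
  rewrite diff_comp// dE /= /f1 !deriveE// -linearZ -linearD /=.
  congr ('d _ _ _); congr (_, _) => /=.
    by rewrite addr0; exact: mulr1.
  by rewrite scaler0 add0r.
apply: ih; apply: CkD => //; apply: CkZ => //.
apply: (@CkZ _ _ _ _ _ (fun=> v.1)) => //; first exact: Ck_cst.
exact: Ck_speed.
Qed.

(** [psi] is defined on the whole space, so a local smooth extension of [f] can simply be pulled
    back, also at the end points of [0,1]. *)
Lemma smooth_on_reparam (A : set (R^o * V)) (f : R^o * V -> W) :
  smooth_on A f -> smooth_on (psi @^-1` A) (f \o psi).
Proof.
move=> sf z Az; have [U [g [oU Uz Cg fg]]] := sf _ Az.
exists (psi @^-1` U), (g \o psi); split => //.
- by move/continuousP : continuous_psi; exact.
- by move=> k; exact: Ck_reparam.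
- by move=> y Uy Ay; exact: fg.
Qed.

Lemma smooth_on_speed (A : set (R^o * V)) (f : R^o * V -> W) :
  smooth_on A f -> smooth_on A (fun z => speed z *: f z).
Proof.
move=> sf z Az; have [U [g [oU Uz Cg fg]]] := sf _ Az.
exists U, (fun z => speed z *: g z); split => //.
- by move=> k; apply: CkZ => //; exact: Ck_speed.
- by move=> y Uy Ay; rewrite fg.
Qed.

End TimeReparametrisation.

Lemma smooth_onZ (R : realType) (V W : normedModType R) (A : set V) (f : V -> W)
  (c : R) : smooth_on A f -> smooth_on A (fun z => c *: f z).
Proof.
move=> sf z Az; have [U [g [oU Uz Cg fg]]] := sf _ Az.
exists U, (fun z => c *: g z); split => //.
- by move=> k; apply: CkZ => //; exact: Ck_cst.
- by move=> y Uy Ay; rewrite fg.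
Qed.

(** * Iterated integrals of continuous functions with compact support *)

(** Joint convergence at each point of [K] becomes uniform by compactness. It serves twice: for
    slices over a cube and for [H t] over [M]. *)
Lemma compact_uniform_cvg (R : realType) (T : Type) (F : set_system T)
    (FF : Filter F) (Y : topologicalType) (K : set Y) (f : T -> Y -> R)
    (f0 : Y -> R) :
  compact K -> (forall y, K y -> f z.1 z.2 @[z --> (F, nbhs y)] --> f0 y) ->
  (forall y, K y -> f0 z @[z --> y] --> f0 y) ->
  forall e, 0 < e -> \forall t \near F, forall y, K y -> `|f t y - f0 y| < e.
Proof.
move=> cK ff0 cf0 e e0.
move/compact_near_coveringP : cK => /(_ T F (fun t y => `|f t y - f0 y| < e) FF); apply.
move=> y Ky; have e2 : 0 < e / 2 by rewrite divr_gt0.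
have /cvgrPdist_lt/(_ _ e2) [[A B]/= [FA yB] AB] := ff0 _ Ky.
have /cvgrPdist_lt/(_ _ e2) yB' := cf0 _ Ky.
exists (B `&` [set z | `|f0 y - f0 z| < e / 2], A) => /=.
  by split => //; exact: filterI.
move=> [z t] [/= [Bz yz] At]; have /= h := AB (t, z) (conj At Bz).
have := ler_distD (f0 y) (f t z) (f0 z); rewrite (distrC (f t z) (f0 y)); lra.
Qed.

Lemma cvg_mx (R : topologicalType) m n (T : Type) (F : set_system T) (FF : Filter F)
    (f : T -> 'M[R]_(m, n)) (l : 'M[R]_(m, n)) :
  (forall i j, f x i j @[x --> F] --> l i j) -> f x @[x --> F] --> l.
Proof.
move=> fl A [P lP PA]; rewrite /= nbhs_filterE.
have : \forall x \near F, forall ij, P ij.1 ij.2 (f x ij.1 ij.2).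
  by apply: filter_forall => ij; exact: fl _ _ _ (lP _ _).
by apply: filterS => x fx; apply: PA => i j; exact: fx (i, j).
Qed.

Section IterIntegral.
Context {R : realType}.
Notation mu := (@lebesgue_measure R).

Definition supported_in_cube m (K : R) (f : 'rV[R]_m -> R) :=
  forall x, f x != 0 -> forall i, `|x 0 i| <= K.

Let slice m (f : 'rV[R]_m.+1 -> R) (t : R) (y : 'rV[R]_m) : R :=
  f (row_mx (t%:M : 'rV[R]_1) y).

Let continuous_row_mx m :
  continuous (fun z : R * 'rV[R]_m => row_mx (z.1%:M : 'rV[R]_1) z.2 : 'rV[R]_m.+1).
Proof.
move=> z; apply: cvg_mx => i j.
have -> : (fun x : R * 'rV[R]_m => (row_mx (x.1%:M : 'rV[R]_1) x.2 : 'rV[R]_m.+1) i j) =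
   fun x => match fintype.split (j : 'I_(1 + m)) with inl _ => x.1 | inr k => x.2 i k end.
  apply/funext => x; rewrite /row_mx mxE; case: fintype.split => // k.
  by rewrite !ord1 mxE eqxx mulr1n.
have -> : (row_mx (z.1%:M : 'rV[R]_1) z.2 : 'rV[R]_m.+1) i j =
   match fintype.split (j : 'I_(1 + m)) with inl _ => z.1 | inr k => z.2 i k end.
  rewrite /row_mx mxE; case: fintype.split => // k.
  by rewrite !ord1 mxE eqxx mulr1n.
case: fintype.split => k; first exact: cvg_fst.
apply: (@cvg_comp _ _ _ snd (fun y : 'rV[R]_m => y i k) _ (nbhs z.2)).
  exact: cvg_snd.
exact: coord_continuous.
Qed.

Let continuous_slice m (f : 'rV[R]_m.+1 -> R) : continuous f ->
  continuous (fun z => slice f z.1 z.2).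
Proof.
move=> cf z; apply: (@continuous_comp _ _ _
  (fun z : R * 'rV[R]_m => row_mx (z.1%:M : 'rV[R]_1) z.2 : 'rV[R]_m.+1) f).
  exact: continuous_row_mx.
exact: cf.
Qed.

Let continuous_slice1 m (f : 'rV[R]_m.+1 -> R) t : continuous f ->
  continuous (slice f t).
Proof.
move=> cf y; apply: (@continuous_comp _ _ _ (fun y => (t, y)) (fun z => slice f z.1 z.2)).
  by apply: (@cvg_pair _ _ _ (nbhs y) (nbhs t) (nbhs y)); [exact: cvg_cst|exact: cvg_id].
exact: continuous_slice.
Qed.

Let slice_supported m K (f : 'rV[R]_m.+1 -> R) t : supported_in_cube K f ->
  supported_in_cube K (slice f t).
Proof.
by move=> Kf y /Kf /(_ (rshift 1 _)) h i; have := h i; rewrite (row_mxEr (_ : 'rV_1)).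
Qed.

Let slice0 m K (f : 'rV[R]_m.+1 -> R) t : supported_in_cube K f ->
  K < `|t| -> forall y, slice f t y = 0.
Proof.
move=> Kf Kt y; apply/eqP; apply: contraLR Kt => /Kf /(_ (lshift m (0 : 'I_1))).
by rewrite (row_mxEl (_ : 'rV_1)) mxE eqxx mulr1n -leNgt.
Qed.

Let cube_compact m (K : R) : compact [set x : 'rV[R]_m | forall i, `[- K, K]%classic (x ord0 i)].
Proof. exact (@rV_compact R m (fun=> `[- K, K]%classic) (fun=> @segment_compact R (- K) K)). Qed.

Lemma iter_integral_cst0 m : iter_integral (fun _ : 'rV[R]_m => 0) = 0 :> R.
Proof.
elim: m => [//|m ih] /=.
transitivity (\int[mu]_t (0 : R))%R; first by apply: eq_Rintegral => t _; exact: ih.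
by rewrite /Rintegral integral0.
Qed.

(** The Lipschitz bound in dimension [m] is a hypothesis here because it is proved by an induction
    whose step needs this very continuity, to have integrable slices. *)
Let iter_integral_slice_cts m K C (f : 'rV[R]_m.+1 -> R) : 0 <= C ->
  (forall (f g : 'rV[R]_m -> R) e, continuous f -> continuous g ->
    supported_in_cube K f -> supported_in_cube K g ->
    (forall x, `|f x - g x| <= e) ->
    `|iter_integral f - iter_integral g| <= C * e) ->
  continuous f -> supported_in_cube K f ->
  continuous (fun t => iter_integral (slice f t)).
Proof.
move=> C0 lip cf Kf t; apply/cvgrPdist_le => e e0.
(* [C + 1] replaces [C], which may be 0. *)
have e0' : 0 < e / (C + 1) by rewrite divr_gt0// ltr_wpDl.
have : \forall s \near t, forall y : 'rV[R]_m,
    (forall i, `[- K, K]%classic (y ord0 i)) -> `|slice f s y - slice f t y| < e / (C + 1).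
  apply: (@compact_uniform_cvg R R (nbhs t) _ _ _ (slice f) (slice f t) (@cube_compact m K)) => //.
  - by move=> y _; have := @continuous_slice _ _ cf (t, y).
  - by move=> y _; exact: continuous_slice1.
apply: filterS => s st; rewrite distrC.
apply: (@le_trans _ _ (C * (e / (C + 1)))).
  apply: lip; [exact: continuous_slice1|exact: continuous_slice1|
    exact: slice_supported|exact: slice_supported|].
  move=> y; have [Ky|Ky] := pselect ([set x : 'rV[R]_m | forall i, `[- K, K]%classic (x ord0 i)] y).
    exact/ltW/st.
  have y0 r : slice f r y = 0.
    apply: contra_notP Ky => /eqP /(slice_supported Kf) h i.
    by have := h i; rewrite /= in_itv /= ler_norml.
  by rewrite !y0 subrr normr0 ltW.
by rewrite mulrCA ler_piMr ?(ltW e0)// ler_pdivrMr ?mul1r; lra.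
Qed.

Let Rintegral_cube m K (f : 'rV[R]_m.+1 -> R) : supported_in_cube K f ->
  iter_integral f = (\int[mu]_(t in `[(- K)%R, K]) iter_integral (slice f t))%R.
Proof.
move=> Kf /=; rewrite [RHS]Rintegral_mkcond; apply: eq_Rintegral => t _.
rewrite patchE; case: ifPn => // tK.
rewrite -[RHS](iter_integral_cst0 m); congr iter_integral; apply/funext => y.
apply: slice0 Kf _ _; rewrite ltNge ler_norml; apply: contraNN tK => tK.
by rewrite inE /= in_itv.
Qed.

Let cts_integrable (f : R -> R) (K : R) : continuous f ->
  mu.-integrable `[- K, K] (EFin \o f).
Proof.
move=> cf; apply: continuous_compact_integrable; first exact: segment_compact.
exact: continuous_subspaceT.
Qed.

(** The constant is the volume of the cube: each of the [m] integrations runs over an interval of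
    length [2 * K]. *)
Lemma iter_integral_lipschitz m K (f g : 'rV[R]_m -> R) e : 0 <= K ->
  continuous f -> continuous g ->
  supported_in_cube K f -> supported_in_cube K g ->
  (forall x, `|f x - g x| <= e) ->
  `|iter_integral f - iter_integral g| <= (2 * K) ^+ m * e.
Proof.
move=> K0; elim: m f g e => [|m ih] f g e cf cg Kf Kg fg.
  by rewrite expr0 mul1r /=.
have C0 : 0 <= (2 * K) ^+ m by rewrite exprn_ge0// mulr_ge0.
have cF h := iter_integral_slice_cts (f := h) C0 ih.
rewrite (Rintegral_cube Kf) (Rintegral_cube Kg) -RintegralB//=; last 2 first.
- by apply: cts_integrable; exact: cF.
- by apply: cts_integrable; exact: cF.
have cFG : continuous (fun t => iter_integral (slice f t) - iter_integral (slice g t)).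
  by move=> t; apply: cvgB; exact: cF.
have e0 : 0 <= e by apply: le_trans (fg 0).
apply: le_trans (le_normr_Rintegral _ _) _ => //; first exact: cts_integrable.
apply: (@le_trans _ _ (\int[mu]_(t in `[(- K)%R, K]) ((2 * K) ^+ m * e))%R).
  apply: le_Rintegral => //.
  - apply: (@cts_integrable (fun t => `|iter_integral (slice f t) - iter_integral (slice g t)|)).
    by move=> t; apply: cvg_norm; exact: cFG.
  - by apply: (@cts_integrable (cst ((2 * K) ^+ m * e))) => t; exact: cvg_cst.
  - move=> t _; apply: ih; [exact: continuous_slice1|exact: continuous_slice1|
      exact: slice_supported|exact: slice_supported|].
    by move=> y; exact: fg.
rewrite Rintegral_cst// [X in _ * X](_ : _ = 2 * K); first by rewrite exprS; lra.
have /= := @lebesgue_measure_itv R `[- K, K]; rewrite lte_fin => ->.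
case: ifPn => [_|]; first by rewrite /=; lra.
by rewrite -leNgt /=; lra.
Qed.

Lemma iter_integralZ m K c (f : 'rV[R]_m -> R) : 0 <= K ->
  continuous f -> supported_in_cube K f ->
  iter_integral (fun x => c * f x) = c * iter_integral f.
Proof.
move=> K0; elim: m f => [//|m ih] f cf Kf.
rewrite (@Rintegral_cube _ K (fun x => c * f x)); last first.
  by move=> x; rewrite mulf_eq0 negb_or => /andP[_ /Kf].
rewrite (Rintegral_cube Kf) -RintegralZl//; last first.
  apply: cts_integrable; apply: (@iter_integral_slice_cts _ K ((2 * K) ^+ m)) => //.
    by rewrite exprn_ge0// mulr_ge0.
  by move=> *; exact: iter_integral_lipschitz.
apply: eq_Rintegral => t _; rewrite -ih//; first exact: continuous_slice1.
exact: slice_supported.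
Qed.

End IterIntegral.

(** * Continuity of the volume density in a chart *)

Section SmoothOnOpen.
Context {R : realType} {V W : normedModType R}.

Lemma Ck_local k (A : set V) (f : V -> W) :
  (forall x, A x -> exists U, [/\ open U, U x & Ck k U f]) -> Ck k A f.
Proof.
elim: k f => [|k ih] f /= fA.
  by move=> x /fA[U [_ Ux]]; exact.
split => [x /fA[U [_ Ux []]]|v]; first by move=> + _; exact.
by apply: ih => x /fA[U [oU Ux [_ Df]]]; exists U; split.
Qed.

(** On an open set the local extensions agree with [f] near each point, so the derivatives are those
    of [f] itself. *)
Lemma smooth_on_Ck k (A : set V) (f : V -> W) : open A -> smooth_on A f -> Ck k A f.
Proof.
move=> oA sf; apply: Ck_local => x /[dup] Ax /sf[U [g [oU Ux Cg fg]]].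
have oUA : open (U `&` A) by exact: openI.
exists (U `&` A); split => //; apply: (Ck_ext oUA (f := g)).
  by move=> y [Uy Ay]; rewrite fg.
by apply: Ck_subset (Cg k) => y [].
Qed.

End SmoothOnOpen.

Section Pairing.
Context {R : realType} {m : nat}.

Lemma pairingE (a : 'cV[R]_m) v : pairing a v = \sum_k v 0 k * a k 0.
Proof. by rewrite /pairing mxE. Qed.

Lemma cvg_sum_ord (T : Type) (F : set_system T) (FF : Filter F) k
    (f : 'I_k -> T -> R) (l : 'I_k -> R) :
  (forall i, f i x @[x --> F] --> l i) ->
  \sum_i f i x @[x --> F] --> \sum_i l i.
Proof. by move=> fl; apply: (cvg_big (@add_continuous R)) => i _; exact: fl.
Qed.

Lemma cvg_pairing (T : Type) (F : set_system T) (FF : Filter F)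
    (a : T -> 'cV[R]_m) (b : 'cV[R]_m) v :
  a x @[x --> F] --> b -> pairing (a x) v @[x --> F] --> pairing b v.
Proof.
move=> ab; rewrite pairingE; under eq_fun do rewrite pairingE.
apply: cvg_sum_ord => k; apply: cvgM; first exact: cvg_cst.
apply: (@cvg_comp _ _ _ a (fun y : 'cV[R]_m => y k 0) _ (nbhs b)) => //.
exact: coord_continuous.
Qed.

(** Pairing with a fixed [v] is linear and continuous, hence commutes with directional
    derivatives. *)
Lemma derive_pairing (V : normedModType R) (a : V -> 'cV[R]_m) v w x :
  differentiable a x ->
  'D_w (fun z => pairing (a z) v : R^o) x = pairing ('D_w a x) v.
Proof.
move=> da.
pose L (b : 'cV[R]_m) : R^o := pairing b v.
have linL : linear L.
  move=> c b b'; rewrite /L /pairing mulmxDr -scalemxAr !mxE//.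
pose linLM := GRing.isLinear.Build _ _ _ _ L linL.
pose LL : {linear 'cV[R]_m -> R^o} := HB.pack L linLM.
have cL : continuous LL by move=> b; exact: (@cvg_pairing _ (nbhs b) _ id).
have dL : differentiable LL (a x) by exact: linear_differentiable.
rewrite -[LHS]/('D_w (LL \o a) x) deriveE; last exact: differentiable_comp.
have dLE : 'd LL (a x) = LL :> ('cV[R]_m -> R^o) by exact: diff_lin.
by rewrite diff_comp// -[LHS]/('d LL (a x) ('d a x w)) dLE [in RHS]deriveE.
Qed.

End Pairing.

Section WedgeContinuity.
Context {R : realType} {V : normedModType R} {T : Type} {F : set_system T}
  {FF : Filter F}.

Lemma cvg_wedge k l (a : T -> @multi_form R V k) a0 (b : T -> @multi_form R V l) b0 :
  (forall u, a x u @[x --> F] --> a0 u) -> (forall u, b x u @[x --> F] --> b0 u) ->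
  forall u, wedge (a x) (b x) u @[x --> F] --> wedge a0 b0 u.
Proof.
move=> aa0 bb0 u; rewrite /wedge; apply: cvgM; first exact: cvg_cst.
apply: (cvg_big (@add_continuous R)) => s _.
apply: cvgM; last exact: bb0.
by apply: cvgM; [exact: cvg_cst|exact: aa0].
Qed.

Lemma cvg_wedge_pow n (a : T -> @multi_form R V 2) a0 :
  (forall u, a x u @[x --> F] --> a0 u) ->
  forall u, wedge_pow (a x) n u @[x --> F] --> wedge_pow a0 n u.
Proof.
move=> aa0; elim: n => [|n ih] u /=; first exact: cvg_cst.
exact: cvg_wedge.
Qed.

End WedgeContinuity.

Section Charts.
Context {R : realType} {m : nat} {M : closed_manifold R m}.
Implicit Types (i : chart M).

Lemma cinvK i x : img i x -> cmap i (cinv i x) = x.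
Proof. by move=> [p ip <-]; rewrite cmapK. Qed.

Lemma img_cmap i p : dom i p -> img i (cmap i p).
Proof. by exists p. Qed.

Lemma near_img i x : img i x -> \forall y \near x, img i y.
Proof. by move=> ix; apply: open_nbhs_nbhs; split => //; exact: img_open. Qed.

End Charts.

Section VolumeDensity.
Context {R : realType} {n : nat} {M : closed_manifold R n.*2.+1}.
Implicit Types (i : chart M).

(** The density is a polynomial in the components of [a] and their first derivatives, so class [C^1]
    suffices. *)
Lemma nu_continuous (a : one_form M) i x : img i x ->
  {for x, continuous (fun y => nu a i (cinv i y))}.
Proof.
move=> ix; have C1 := smooth_on_Ck 1 (@img_open _ _ M i) (@form_smooth _ _ _ a i).
have [dF DF] := C1.
(* [ext_deriv] differentiates at [cmap i (cinv i y)], which is [y] only inside the image of the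
   chart; hence the identity is stated near [x]. *)
have near_ext u : \forall y \near x,
    pairing ('D_(u ord0) (a i \o cinv i) y) (u ord_max) -
    pairing ('D_(u ord_max) (a i \o cinv i) y) (u ord0) = ext_deriv a i (cinv i y) u.
  near=> y; have iy : img i y by near: y; exact: near_img.
  by rewrite /ext_deriv (cinvK iy) !derive_pairing//; exact: dF.
rewrite /prop_for /continuous_at /nu.
apply: (@cvg_wedge _ _ _ (nbhs x) _ _ _ (fun y => one_form_multi a i (cinv i y)) _
  (fun y => wedge_pow (ext_deriv a i (cinv i y)) n)) => [u|].
  rewrite /one_form_multi.
  apply: (@cvg_pairing _ _ _ _ _ (a i \o cinv i)).
  exact/differentiable_continuous/dF.
apply: cvg_wedge_pow => u.
apply: cvg_trans (near_eq_cvg (near_ext u)) _.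
rewrite -(nbhs_singleton (near_ext u)).
by apply: cvgB; apply: cvg_pairing; apply: DF.
Unshelve. all: by end_near. Qed.

End VolumeDensity.

(** * Continuity in time of the norm of a Hamiltonian *)

Section ChartIntegral.
Context {R : realType} {n : nat} {M : closed_manifold R n.*2.+1}.
Variables (a : one_form M) (P : partition_of_unity M).
Implicit Types (f : M -> R).

Let weight k f : 'rV[R]_n.*2.+1 -> R :=
  (fun x => let p := cinv (pou_chart P k) x in
    pou_fun P k p * f p * `|nu a (pou_chart P k) p|) \_ (img (pou_chart P k)).

(** This compact set depends on the partition only, so the cube containing the support can be chosen
    before [f]. *)
Let supp k : set 'rV[R]_n.*2.+1 :=
  cmap (pou_chart P k) @` closure [set p | pou_fun P k p != 0].

Let supp_compact k : compact (supp k).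
Proof.
apply: continuous_compact.
  apply/subspace_continuousP => p pk; apply: cvg_within_filter.
  by apply: cmap_cont; exact: pou_supp pk.
by apply: (subclosed_compact _ (@carrier_compact _ _ M)) => //; exact: closed_closure.
Qed.

Let weight_supp k f x : ~ supp k x -> weight k f x = 0.
Proof.
move=> kx; rewrite /weight patchE; case: ifPn => // /set_mem ix.
have [->|p0] := eqVneq (pou_fun P k (cinv (pou_chart P k) x)) 0.
  by rewrite !mul0r.
case: kx; exists (cinv (pou_chart P k) x); last exact: cinvK.
exact: subset_closure.
Qed.

Let supp_img k : supp k `<=` img (pou_chart P k).
Proof. by move=> x [p /pou_supp kp <-]; exists p. Qed.

(** Extension by 0 outside the chart creates no jump: [supp k] is closed and lies inside the open
    image, so near any point the function is either 0 or given by the formula in the chart. *)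
Let weight_continuous k f : continuous f -> continuous (weight k f).
Proof.
move=> cf x; have [kx|kx] := pselect (supp k x); last first.
  have clk : closed (supp k) by apply: compact_closed => //; exact: norm_hausdorff.
  rewrite /continuous_at weight_supp//.
  have : \forall y \near x, 0 = weight k f y.
    have : nbhs x (~` supp k).
      by apply: open_nbhs_nbhs; split => //; exact: closed_openC.
    by apply: filterS => y ky; rewrite weight_supp.
  by move=> /near_eq_cvg h; apply: cvg_trans h _; exact: cvg_cst.
have ix := supp_img kx; pose i := pou_chart P k.
have near_ext : \forall y \near x,
    pou_fun P k (cinv i y) * f (cinv i y) * `|nu a i (cinv i y)| = weight k f y.
  by apply: filterS (near_img ix) => y iy; rewrite /weight patchE mem_set.
rewrite /continuous_at -(nbhs_singleton near_ext).
apply: cvg_trans (near_eq_cvg near_ext) _.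
have ci : {for x, continuous (cinv i)} by exact: cinv_cont.
apply: cvgM; last by apply: cvg_norm; exact: nu_continuous.
apply: cvgM.
  by apply: (@cvg_comp _ _ _ (cinv i) (pou_fun P k) _ _ _ ci); exact: pou_cont.
by apply: (@cvg_comp _ _ _ (cinv i) f _ _ _ ci); exact: cf.
Qed.

Let weight_cube k : exists2 K, 0 <= K & forall f, supported_in_cube K (weight k f).
Proof.
have [B [_ /= Bk]] := compact_bounded (@supp_compact k).
exists (`|B| + 1); first by rewrite addr_ge0.
move=> f x wx j.
have kx : supp k x by apply: contrapT => kx; rewrite weight_supp ?eqxx in wx.
have := Bk (`|B| + 1); rewrite (le_lt_trans (ler_norm _)) ?ltrDl// => /(_ isT _ kx).
apply: le_trans; rewrite [leRHS]/Num.Def.normr/= mx_normrE.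
by apply: (@le_bigmax _ _ _ _ (fun i : 'I_1 * 'I_n.*2.+1 => `|x i.1 i.2|) (0, j)).
Qed.

Let weight_bound k : exists2 B, 0 <= B & forall x, `|weight k (fun=> 1) x| <= B.
Proof.
have cw : continuous (weight k (fun=> 1)).
  by apply: weight_continuous; exact: cst_continuous.
have [B [_ /= Bk]] := compact_bounded
  (continuous_compact (continuous_subspaceT cw) (@supp_compact k)).
exists (`|B| + 1); first by rewrite addr_ge0.
move=> x; have [kx|kx] := pselect (supp k x); last first.
  by rewrite weight_supp// normr0 addr_ge0.
apply: Bk; last by exists x.
by rewrite (le_lt_trans (ler_norm _))// ltrDl.
Qed.

Let weightE k f x : weight k f x = weight k (fun=> 1) x * f (cinv (pou_chart P k) x).
Proof.
by rewrite /weight !patchE; case: ifPn => // _; rewrite ?mul0r// mulr1 mulrAC.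
Qed.

(** By [weightE] the integrand is [f] times a bounded density, so each chart contributes the volume
    of its cube times the bound on that density. *)
Lemma integral_nu_lipschitz : exists2 C, 0 <= C & forall f f' e,
  continuous f -> continuous f' -> (forall p, `|f p - f' p| <= e) ->
  `|integral_nu a P f - integral_nu a P f'| <= C * e.
Proof.
have chart_lip k : exists C, 0 <= C /\ forall f f' e,
    continuous f -> continuous f' -> (forall p, `|f p - f' p| <= e) ->
    `|iter_integral (weight k f) - iter_integral (weight k f')| <= C * e.
  have [K K0 Kw] := weight_cube k; have [B B0 Bw] := weight_bound k.
  exists ((2 * K) ^+ n.*2.+1 * B); split.
    by rewrite mulr_ge0// exprn_ge0// mulr_ge0.
  move=> f f' e cf cf' ff'; rewrite -mulrA; apply: iter_integral_lipschitz => //.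
  - exact: weight_continuous.
  - exact: weight_continuous.
  - by move=> x; rewrite weightE (weightE _ f') -mulrBr normrM ler_pM.
have [C CP] := choice chart_lip.
exists (\sum_k C k); first by apply: sumr_ge0 => k _; have [] := CP k.
move=> f f' e cf cf' ff'; rewrite /integral_nu -sumrB mulr_suml.
apply: le_trans (ler_norm_sum _ _ _) _; apply: ler_sum => k _.
by have [_] := CP k; apply.
Qed.

Lemma integral_nuZ c f : continuous f ->
  integral_nu a P (fun p => c * f p) = c * integral_nu a P f.
Proof.
move=> cf; rewrite /integral_nu mulr_sumr; apply: eq_bigr => k _.
have [K K0 Kw] := weight_cube k.
rewrite -[RHS](iter_integralZ c K0 (weight_continuous (k := k) cf) (Kw f)).
congr iter_integral; apply/funext => x.
by rewrite -[LHS]/(weight k (fun p => c * f p) x) weightE (weightE _ f) mulrCA.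
Qed.

End ChartIntegral.

Section HamNorm.
Context {R : realType} {n : nat} {M : closed_manifold R n.*2.+1}.
Variables (a : one_form M) (P : partition_of_unity M).
Implicit Types (f : M -> R).

Let range_bounds f : continuous f ->
  [/\ range f !=set0, has_ubound (range f) & has_lbound (range f)].
Proof.
move=> cf; have [p _] := @carrier_nonempty _ _ M.
have [B [_ /= Bf]] := compact_bounded
  (continuous_compact (continuous_subspaceT cf) (@carrier_compact _ _ M)).
have {}Bf q : `|f q| <= `|B| + 1.
  apply: Bf; last by exists q.
  by rewrite (le_lt_trans (ler_norm _))// ltrDl.
split; first by exists (f p), p.
  by exists (`|B| + 1) => _ [q _ <-]; have := Bf q; rewrite ler_norml => /andP[].
by exists (- (`|B| + 1)) => _ [q _ <-]; have := Bf q; rewrite ler_norml => /andP[].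
Qed.

Let sup_range_le f f' c : continuous f -> continuous f' ->
  (forall p, f p <= f' p + c) -> sup (range f) <= sup (range f') + c.
Proof.
move=> /range_bounds[f0 fu fl] /range_bounds[f'0 f'u f'l] ff'.
apply: ge_sup => // _ [p _ <-]; apply: le_trans (ff' p) _.
by rewrite lerD2r; apply: ub_le_sup => //; exists p.
Qed.

Let inf_range_le f f' c : continuous f -> continuous f' ->
  (forall p, f p <= f' p + c) -> inf (range f) <= inf (range f') + c.
Proof.
move=> /range_bounds[f0 fu fl] /range_bounds[f'0 f'u f'l] ff'.
rewrite -lerBlDr; apply: lb_le_inf => // _ [p _ <-]; rewrite lerBlDr.
by apply: le_trans (ff' p); apply: ge_inf => //; exists p.
Qed.

Lemma ham_norm_ge0 f : continuous f -> 0 <= ham_norm a P f.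
Proof.
move=> /range_bounds[[_ [p _ _]] fu fl]; rewrite /ham_norm addr_ge0// subr_ge0.
by apply: (@le_trans _ _ (f p)); [apply: ge_inf => //; exists p|apply: ub_le_sup => //; exists p].
Qed.

Lemma ham_norm_lipschitz : exists2 C, 0 <= C & forall f f' e,
  continuous f -> continuous f' -> (forall p, `|f p - f' p| <= e) ->
  `|ham_norm a P f - ham_norm a P f'| <= C * e.
Proof.
have [C C0 CP] := integral_nu_lipschitz a P.
pose v := `|(integral_nu a P (fun=> 1))^-1|.
have v0 : 0 <= v by exact: normr_ge0.
(* [sup] and [inf] are each 1-Lipschitz for the uniform norm; [v * C] comes from the mean value. *)
exists (2 + v * C); first by rewrite addr_ge0// mulr_ge0.
move=> f f' e cf cf' ff'.
have ff'1 p : f p <= f' p + e by have := ff' p; rewrite ler_norml => /andP[]; lra.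
have ff'2 p : f' p <= f p + e by have := ff' p; rewrite ler_norml => /andP[]; lra.
have s1 := sup_range_le cf cf' ff'1; have s2 := sup_range_le cf' cf ff'2.
have i1 := inf_range_le cf cf' ff'1; have i2 := inf_range_le cf' cf ff'2.
have := CP _ _ _ cf cf' ff'; rewrite /ham_norm !normrM -/v.
set I := integral_nu a P f; set I' := integral_nu a P f' => II'.
have : `|v * `|I| - v * `|I'| | <= v * (C * e).
  rewrite -mulrBr normrM (ger0_norm v0) ler_wpM2l//.
  by apply: le_trans II'; exact: ler_dist_dist.
by rewrite !ler_norml => /andP[h1 h2]; apply/andP; split; lra.
Qed.

Lemma ham_normZ c f : 0 < c -> continuous f ->
  ham_norm a P (fun p => c * f p) = c * ham_norm a P f.
Proof.
move=> c0 cf; rewrite /ham_norm integral_nuZ// !mulrDr.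
have [f0 fu fl] := range_bounds cf.
have cvcf : continuous (fun p => c * f p).
  by move=> p; exact: (continuousM (@cst_continuous _ _ c p) (cf p)).
have [cf0 cfu cfl] := range_bounds cvcf.
congr (_ + _ + _).
- apply/eqP; rewrite eq_le; apply/andP; split.
    apply: ge_sup => // _ [p _ <-]; rewrite ler_pM2l//.
    by apply: ub_le_sup => //; exists p.
  rewrite mulrC -ler_pdivlMr//; apply: ge_sup => // _ [p _ <-].
  by rewrite ler_pdivlMr// mulrC; apply: ub_le_sup => //; exists p.
- rewrite mulrN; congr (- _); apply/eqP; rewrite eq_le; apply/andP; split.
    rewrite mulrC -ler_pdivrMr//; apply: lb_le_inf => // _ [p _ <-].
    by rewrite ler_pdivrMr// mulrC; apply: ge_inf => //; exists p.
  apply: lb_le_inf => // _ [p _ <-]; rewrite ler_pM2l//.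
  by apply: ge_inf => //; exists p.
- by rewrite mulrCA normrM gtr0_norm.
Qed.

Section Time.
Variables (H : R -> M -> R) (hH : smooth_hamiltonian H).

(** Continuity jointly in time and space, restricted to [0,1], where alone [H] is assumed smooth; it
    is read off from a local smooth extension in a chart. *)
Let cvg_hamiltonian t p : I01 R t ->
  H z.1 z.2 @[z --> (within (I01 R) (nbhs t), nbhs p)] --> H t p.
Proof.
move=> t01; have [i ip] := dom_cover p.
have [|U [g [oU Utp Cg Hg]]] := hH (i := i) (x := (t, cmap i p)).
  by split => //; exact: img_cmap.
have gtp : {for (t, cmap i p), continuous g} by exact: (Cg 0%N).
have gE : g (t, cmap i p) = H t p.
  by rewrite -Hg//=; [rewrite cmapK|split => //; exact: img_cmap].
move=> N HN; have gN : nbhs (t, cmap i p) (g @^-1` N `&` U).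
  apply: filterI; last exact: open_nbhs_nbhs.
  by apply: gtp; rewrite gE.
have [[A B] /= [tA pB] AB] := gN.
exists (A `&` I01 R, cmap i @^-1` B `&` dom i) => /=.
  split; first by rewrite /within /=; apply: filterS tA => s As s01.
  apply: filterI; first by apply: cmap_cont.
  by apply: open_nbhs_nbhs; split => //; exact: dom_open.
move=> [s q] [/= [As s01] [Bq iq]].
have [/= Nsq Usq] := AB (s, cmap i q) (conj As Bq).
have := Hg _ Usq (conj s01 (img_cmap iq)); rewrite /= cmapK// => ->.
exact: Nsq.
Qed.

Lemma hamiltonian_continuous t : I01 R t -> continuous (H t).
Proof.
move=> t01 p N /(cvg_hamiltonian t01)[[A B] /= [tA pB] AB].
apply: filterS pB => q Bq; apply: (AB (t, q)); split => //=.
exact: nbhs_singleton tA t01.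
Qed.

Lemma ham_norm_continuous : {within I01 R, continuous (fun t => ham_norm a P (H t))}.
Proof.
apply/subspace_continuousP => t t01; apply/cvgrPdist_le => e e0.
have [C C0 CP] := ham_norm_lipschitz.
have e0' : 0 < e / (C + 1) by rewrite divr_gt0// ltr_wpDl.
have : \forall s \near within (I01 R) (nbhs t), forall p, setT p ->
    `|H s p - H t p| < e / (C + 1).
  apply: (@compact_uniform_cvg R R _ _ M setT H (H t)) => //.
  - exact: carrier_compact.
  - by move=> p _; exact: cvg_hamiltonian.
  - by move=> p _; exact: hamiltonian_continuous.
rewrite !near_withinE; apply: filterS => s Hs s01; rewrite distrC.
apply: (@le_trans _ _ (C * (e / (C + 1)))).
  apply: CP; [exact: hamiltonian_continuous|exact: hamiltonian_continuous|].
  by move=> p; exact/ltW/(Hs s01).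
by rewrite mulrCA ler_piMr ?(ltW e0)// ler_pdivrMr ?mul1r; lra.
Qed.

End Time.
End HamNorm.

(** * Reparametrised isotopies *)

Section Reparametrisation.
Context {R : realType} {m : nat} {M : closed_manifold R m}.
Variables (zeta : R -> R) (p : {poly R}) (c : R).
Hypothesis zeta0 : zeta 0 = 0.
Hypothesis zeta1 : zeta 1 = 1.
Hypothesis zeta_incr : {homo zeta : s t / s < t}.
Hypothesis zeta_surj : forall s, exists t, zeta t = s.
Hypothesis p_gt0 : forall x, 0 < p.[x].
Hypothesis dzeta : forall t : R, is_derive t 1 zeta (c / p.[zeta t]).

Let zeta_mono : {mono zeta : s t / s <= t}.
Proof. exact: le_mono. Qed.

Let zeta_inj : injective zeta.
Proof. by move=> s t st; apply/eqP; rewrite eq_le -(zeta_mono s) -(zeta_mono t) st lexx. Qed.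

Lemma I01_reparam t : I01 R (zeta t) = I01 R t.
Proof.
by rewrite /I01 /= !in_itv /= -(zeta_mono 0 t) -(zeta_mono t 1) zeta0 zeta1.
Qed.

Lemma image_reparam T (f : R -> T) : [set f (zeta t) | t in I01 R] = f @` I01 R.
Proof.
apply/seteqP; split => [_ [t t01 <-]|_ [s s01 <-]].
  by exists (zeta t) => //; rewrite I01_reparam.
by have [t ts] := zeta_surj s; exists t; [rewrite -I01_reparam ts|rewrite ts].
Qed.

Let p_neq0 x : p.[x] != 0. Proof. exact: lt0r_neq0. Qed.

Let dzetaC (t : R) : is_derive t 1 zeta ((c%:P).[zeta t] / p.[zeta t]).
Proof. by rewrite hornerC. Qed.

Let smooth_on_subset (V W : normedModType R) (A A' : set V) (f g : V -> W) :
  A' `<=` A -> f =1 g -> smooth_on A f -> smooth_on A' g.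
Proof.
move=> AA' /funext <- sf x /AA' /sf[U [h [oU Ux Ch fh]]].
by exists U, h; split => // y Uy /AA'; exact: fh.
Qed.

Lemma smooth_hamiltonian_reparam (H : R -> M -> R) : smooth_hamiltonian H ->
  smooth_hamiltonian (fun t q => c / p.[zeta t] * H (zeta t) q).
Proof.
move=> hH i.
have := smooth_on_reparam p_neq0 dzetaC (smooth_on_speed c%:P p_neq0 (hH i)).
apply: smooth_on_subset => [[t x] /= []|[t x] /=]; last by rewrite hornerC.
by rewrite I01_reparam.
Qed.

Let zeta_cts : continuous zeta.
Proof.
move=> t; apply: differentiable_continuous; apply/derivable1_diffP.
exact: ex_derive.
Qed.

Lemma smooth_isotopy_reparam (Phi : R -> diffeo M) : smooth_isotopy Phi ->
  smooth_isotopy (Phi \o zeta).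
Proof.
move=> [cPhi sPhi]; split; last first.
  move=> i j; have := smooth_on_reparam p_neq0 dzetaC (sPhi i j).
  by apply: smooth_on_subset => [[t x] /= []|[t x] //]; rewrite I01_reparam.
apply/subspace_continuousP => -[t q] [/= t01 _].
have /subspace_continuousP/(_ (zeta t, q)) := cPhi.
rewrite /= I01_reparam => /(_ (conj t01 I)).
apply: cvg_trans.
apply: (@cvg_comp _ _ _ (fun z : R * M => (zeta z.1, z.2))
  (fun z : R * M => Phi z.1 z.2) _
  (within (I01 R `*` [set: M]) (nbhs (zeta t, q)))); last exact: cvg_id.
move=> A [[B D] /= [tB qD] BD]; exists (zeta @^-1` B, D) => /=.
  by split => //; exact: zeta_cts.
by move=> [s r] [/= Bs Dr] [/= s01 _]; apply: (BD (zeta s, r)) => //=; rewrite I01_reparam.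
Qed.

(** A chain rule that also covers the one-sided quotients at 0 and 1. In Carathéodory form,
    [zeta s - zeta t] is [g s] times [s - t] with [g] continuous at [t], so the new quotient is
    [g s] times the old one at [zeta s]. *)
Lemma velocity_reparam (gam : R -> M) t i v :
  velocity gam (zeta t) i v -> velocity (gam \o zeta) t i (c / p.[zeta t] *: v).
Proof.
move=> gv; have [g [gE gc gt]] := (is_derive1_caratheodory _ _ _).1 (dzeta t).
(* Injectivity of [zeta] keeps [zeta s] away from [zeta t], as the punctured filter requires. *)
have zt : zeta s @[s --> within (I01 R) (t^')] --> within (I01 R) ((zeta t)^').
  move=> A; rewrite /= !near_simpl !near_withinE => At.
  have : \forall s \near t, zeta s != zeta t -> I01 R (zeta s) -> A (zeta s).
    exact: zeta_cts At.
  apply: filterS => s As st s01.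
  apply: As; last by rewrite I01_reparam.
  by apply: contra_neq st => /zeta_inj.
have gt' : g s @[s --> within (I01 R) (t^')] --> c / p.[zeta t].
  rewrite -gt; apply: (@cvg_comp _ _ _ id g _ (nbhs t)); last exact: gc.
  exact: cvg_trans (cvg_within _) (cvg_within _).
apply: cvg_trans (cvgZ gt' (cvg_comp _ _ zt gv)); apply: near_eq_cvg.
rewrite !near_withinE; near=> s => st s01 /=.
have st0 : s - t != 0 by rewrite subr_eq0.
have zst0 : zeta s - zeta t != 0.
  by rewrite subr_eq0; apply: contra_neq st => /zeta_inj.
rewrite scalerA; congr (_ *: _); apply: (mulfI st0).
by rewrite mulfV// mulrA (mulrC _ (g s)) -gE mulfV.
Unshelve. all: by end_near. Qed.

End Reparametrisation.

Section ScaledField.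
Context {R : realType} {m : nat} {M : closed_manifold R m}.
Variables (X : vector_field M) (c : R).

Let scaled_smooth i : smooth_on (img i) ((fun q => c *: X i q) \o cinv i).
Proof. exact: (smooth_onZ c (@vec_smooth _ _ _ X i)). Qed.

Let scaled_trans i j q : dom i q -> dom j q -> c *: X j q = dtrans i j q (c *: X i q).
Proof. by move=> iq jq; rewrite (vec_trans X iq jq) /dtrans linearZ. Qed.

Definition scale_vector_field : vector_field M :=
  @VectorField _ _ _ (fun i q => c *: X i q) scaled_smooth scaled_trans.

End ScaledField.

(** Freezing the time variable in a local smooth extension; the result allows the factor [c /
    p.[zeta t]] to be taken out of the differential when [F] is shown to be basic. *)
Lemma hamiltonian_differentiable (R : realType) m (M : closed_manifold R m)
    (H : R -> M -> R) t i q : smooth_hamiltonian H -> I01 R t -> dom i q ->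
  differentiable (fun x => H t (cinv i x) : R^o) (cmap i q).
Proof.
move=> hH t01 iq.
have [|U [g [oU Utq Cg Hg]]] := hH i (t, cmap i q).
  by split => //; exact: img_cmap.
have [dg _] := Cg 1%N.
have dpair : differentiable (fun x : 'rV[R]_m => (t, x) : R^o * 'rV[R]_m) (cmap i q).
  by apply: differentiable_pair.
have dgt : differentiable (g \o (fun x : 'rV[R]_m => (t, x))) (cmap i q).
  by apply: differentiable_comp => //; exact: dg.
apply: (near_eq_diff _ dgt).1.
have iq' := near_img (img_cmap iq).
have : \forall x \near cmap i q, U (t, x).
  have := differentiable_continuous dpair.
  by apply; exact: open_nbhs_nbhs.
by apply: filterS2 iq' => x ix Utx; rewrite /= -Hg.
Qed.

Lemma Rintegral_I01_cst (R : realType) (b : R) :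
  (\int[lebesgue_measure]_(t in I01 R) b)%R = b.
Proof.
rewrite Rintegral_cst; last exact: measurable_itv.
have /= := @lebesgue_measure_itv R `[0, 1]; rewrite lte_fin ltr01 => ->.
by rewrite /= subr0 mulr1.
Qed.

Lemma integrable_I01_cst (R : realType) (b : R) :
  (@lebesgue_measure R).-integrable (I01 R) (EFin \o cst b).
Proof.
apply: continuous_compact_integrable; first exact: segment_compact.
by apply: continuous_subspaceT; exact: cst_continuous.
Qed.

(** * Norms in time and the conclusion *)

Section Norms.
Context {R : realType} {n : nat} {M : closed_manifold R n.*2.+1}.
Variables (a : one_form M) (P : partition_of_unity M).

Lemma hamiltonian_integrable (H : R -> M -> R) : smooth_hamiltonian H ->
  (@lebesgue_measure R).-integrable (I01 R) (EFin \o (fun t => ham_norm a P (H t))).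
Proof.
move=> hH; apply: continuous_compact_integrable; first exact: segment_compact.
exact: ham_norm_continuous.
Qed.

Lemma norm_1oo_le (H : R -> M -> R) b : smooth_hamiltonian H ->
  (forall t, I01 R t -> ham_norm a P (H t) <= b) -> norm_1oo a P H <= b.
Proof.
move=> hH Hb; rewrite /norm_1oo.
rewrite -[leRHS]Rintegral_I01_cst; apply: le_Rintegral => //.
- exact: measurable_itv.
- exact: hamiltonian_integrable.
- exact: integrable_I01_cst.
Qed.

End Norms.

Unset Implicit Arguments.
Set Strict Implicit.

Theorem lemma8p4 (R : realType) (n : nat) (M : closed_manifold R n.*2.+1)
    (alpha : one_form M) (halpha : contact_form alpha)
    (Rb : vector_field M) (hRb : is_reeb alpha Rb)
    (g : riemannian_metric M) (P : partition_of_unity M)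
    (H : R -> M -> R) (hH : smooth_hamiltonian H) (hHb : basic Rb H)
    (PhiH : R -> diffeo M) (hPhiH : strictly_contact_isotopy alpha PhiH)
    (hgen : generates alpha H PhiH) (eps : R) (heps : 0 < eps) :
  exists (F : R -> M -> R) (PhiF : R -> diffeo M),
    [/\ smooth_hamiltonian F, basic Rb F,
        strictly_contact_isotopy alpha PhiF & generates alpha F PhiF] /\
    [/\ PhiF 0 =1 PhiH 0 /\ PhiF 1 =1 PhiH 1,
        norm_1oo alpha P F <= norm_oo alpha P F /\
        norm_oo alpha P F < norm_1oo alpha P H + eps &
        dbar_isotopy g PhiF (fun=> PhiF 0) <
        dbar_isotopy g PhiH (fun=> PhiH 0) + eps].
Proof.
pose h t := ham_norm alpha P (H t).
have h_ge0 t : 0 <= t <= 1 -> 0 <= h t.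
  by move=> t01; apply/ham_norm_ge0/(hamiltonian_continuous hH); rewrite /I01 /= in_itv.
have eps2 : 0 < eps / 2 by rewrite divr_gt0.
have ch : {within `[0, 1], continuous h} by exact: ham_norm_continuous.
have [p [k k0 kp] hp] := polynomial_majorant ch h_ge0 eps2.
have p_gt0 x : 0 < p.[x] by exact: lt_le_trans (kp x).
have [c_gt0 [zeta [zeta0 zeta1 zeta_incr zeta_surj dzeta]]] := time_change k0 kp.
set c := (antideriv p).[1] in dzeta c_gt0.
have ceps : c <= norm_1oo alpha P H + eps / 2.
  have H_int := @hamiltonian_integrable _ _ _ alpha P _ hH.
  rewrite -(Rintegral_I01_cst (eps / 2)) -RintegralD;
    [|exact: measurable_itv|exact: H_int|exact: integrable_I01_cst].
  rewrite /c -Rintegral_antideriv; apply: le_Rintegral.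
  - exact: measurable_itv.
  - apply: continuous_compact_integrable; first exact: segment_compact.
    by apply: continuous_subspaceT; exact: continuous_horner.
  - apply: continuous_compact_integrable; first exact: segment_compact.
    move=> t; apply: cvgD; last exact: cvg_cst.
    exact: (@ham_norm_continuous _ _ _ alpha P _ hH).
  - by move=> t; rewrite /= in_itv => /hp /andP[].
pose F t q := c / p.[zeta t] * H (zeta t) q.
have hF : smooth_hamiltonian F.
  exact: smooth_hamiltonian_reparam.
have F_norm t : I01 R t -> ham_norm alpha P (F t) <= c.
  rewrite -(I01_reparam zeta0 zeta1 zeta_incr) => t01.
  rewrite ham_normZ ?divr_gt0//; last exact: hamiltonian_continuous.
  rewrite mulrAC ler_pdivrMr// ler_wpM2l ?(ltW c_gt0)//.
  by have /hp/andP[] : 0 <= zeta t <= 1 by move: t01; rewrite /I01 /= in_itv.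
exists F, (PhiH \o zeta); do 2![split].
- exact: hF.
- move=> t i q t01 iq.
  have zt01 : I01 R (zeta t) by rewrite (I01_reparam zeta0 zeta1 zeta_incr).
  have dH := hamiltonian_differentiable hH zt01 iq.
  rewrite (_ : (fun x => _) = (c / p.[zeta t]) *: (fun x => H (zeta t) (cinv i x) : R^o))//.
  by rewrite diffZ// /= hHb// scaler0.
- split; first by apply: smooth_isotopy_reparam => //; exact: hPhiH.1.
  by move=> t t01; apply: hPhiH.2; rewrite (I01_reparam zeta0 zeta1 zeta_incr).
- have [X Xvel XH] := hgen.
  exists (fun t => scale_vector_field (X (zeta t)) (c / p.[zeta t])).
    move=> t i q t01 iq.
    apply: (velocity_reparam zeta0 zeta1 zeta_incr dzeta (gam := fun s => PhiH s q)).
    by apply: Xvel => //; rewrite (I01_reparam zeta0 zeta1 zeta_incr).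
  move=> t i q t01 iq; rewrite /F (XH _ i)//; last first.
    by rewrite (I01_reparam zeta0 zeta1 zeta_incr).
  by rewrite /pairing /= -scalemxAl [RHS]mxE.
- by split => q /=; rewrite ?zeta0 ?zeta1.
(* An upper bound is needed for [sup] to dominate each value; the estimate by [c] supplies it. *)
- have F_bounded : has_ubound [set ham_norm alpha P (F t) | t in I01 R].
    by exists c => _ [t t01 <-]; exact: F_norm.
  split.
    by apply: norm_1oo_le => // t t01; apply: ub_le_sup => //; exists t.
  (* Only half of [eps] was spent on the majorant; the other half makes the inequality strict. *)
  apply: le_lt_trans (_ : c < _); last by apply: le_lt_trans ceps _; lra.
  apply: ge_sup => [|_ [t t01 <-]]; last exact: F_norm.
  by exists (ham_norm alpha P (F 0)), 0 => //; rewrite /I01 /= in_itv /= lexx ler01.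
- rewrite /dbar_isotopy.
  (* Both suprema range over the same set of values, so [eps] serves only for strictness. *)
  rewrite (image_reparam zeta0 zeta1 zeta_incr zeta_surj
    (fun s => dbar g (PhiH s) (PhiH (zeta 0)))).
  by rewrite zeta0 ltrDl.
Qed.
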